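(* Let $X_1,\dots,X_n$ be independent $d$-dimensional random variables with density $f$, let $\alpha\in(0,1)$, and let $\mathcal K_n=\{K^i: i=1,\dots,L_n\}$ be the family of wedges described in the context. For every $i=1,\dots,L_n$ and all $0\le j_i<k_i\le N^i$ with $k_i-j_i>1$ consider the two tests: - the hypothesis ''$f$ is increasing on $K^i(j_i,k_i)$'' is rejected if $T_{K^i(j_i,k_i)}<-\overline c_{K^i(j_i,k_i)}(\alpha)$; - the hypothesis ''$f$ is decreasing on $K^i(j_i,k_i)$'' is rejected if $T_{K^i(j_i,k_i)}>\overline c_{K^i(j_i,k_i)}(\alpha)$. If all these tests are performed simultaneously ($0\le j_i<k_i\le N^i$, $k_i-j_i>1$, $i=1,\dots,L_n$), then the probability of at least one false rejection (i.e. of rejecting at least one hypothesis that is true) is at most $\alpha$.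
   Context: Wedges. For $x_0,e\in\mathbb{R}^d$ with $\|e\|=1$ (Euclidean norm), fix an orthonormal basis $\{e_1,\dots,e_{d-1}\}$ of $(\mathrm{span}\{e\})^\perp$ and put $P_ex:=\langle x-x_0,e\rangle$. The wedge with vertex $x_0$, direction $e$, length $l>0$ and angle $\varphi\in(0,\pi/2)$ is $K(x_0,e,\varphi):=\{x: 0<P_ex\le l,\ \langle x-x_0,e_i\rangle\in[-\tan(\varphi)P_ex,\tan(\varphi)P_ex],\ i=1,\dots,d-1\}$. Family $\mathcal K_n$. Let $l_n=(\log(n)/n)^{1/(d+4)}$, let $C_1,C_2,\varepsilon>0$ be constants and $\varphi_n=\frac{C_2}{2}\log(n)^{-1}$. Let $b_1,\dots,b_d$ be the standard unit vectors and let $\mathcal G_n$ be the grid of vertices $\sum_{j=1}^d(i_j(2+\varepsilon)C_1\log(n)l_n-n)b_j$ with $i_1,\dots,i_d\in\{0,\dots,\lceil 2n/((2+\varepsilon)C_1\log(n)l_n)\rceil\}$. Unit directions $e_n^1,\dots,e_n^{M_n}$ are chosen successively: $e_n^1$ is arbitrary; once $e_n^1,\dots,e_n^{i-1}$ are specified, whenever possible a unit vector $e_n^i$ is chosen with $|\mathrm{angle}(e_n^i,e_n^j)|\ge(2+\varepsilon)\arctan(\sqrt{d-1}\tan(\varphi_n))$ for all $j<i$. $\mathcal K_n=\{K^1,\dots,K^{L_n}\}$ is the family of wedges with length $C_1\log(n)l_n$, angle $\varphi_n$, vertex in $\mathcal G_n$ and direction in $\{e_n^1,\dots,e_n^{M_n}\}$.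 Subsections. For a wedge $K$ with vertex $x_0$ and direction $e$, let $X_{(1)},\dots,X_{(N)}$ be the observations lying in $K$, ordered by increasing $P_e$, and $X_{(0)}:=x_0$. For $0\le j<k\le N$, $k-j>1$, put $K(j,k):=\{x\in K: P_eX_{(j)}<P_ex\le P_eX_{(k)}\}$. $f$ is increasing (resp. decreasing) on $K(j,k)$ if $f(x_0+\tilde t_2e_0)\ge f(x_0+\tilde t_1e_0)$ (resp. $\le$) for all unit vectors $e_0$ and all $\tilde t_2>\tilde t_1\ge0$ with $x_0+\tilde t_\ell e_0\in K(j,k)$, $\ell=1,2$. Statistics. Let $\beta(z)=(2z-1)\mathbf 1_{(0,1)}(z)$, $\Gamma(\delta)=\sqrt{2\log(\exp(1)/\delta)}$, and $$T_{K(j,k)}=\sum_{l=j+1}^{k-1}\beta\left(\frac{(P_eX_{(l)})^d-(P_eX_{(j)})^d}{(P_eX_{(k)})^d-(P_eX_{(j)})^d}\right),\qquad T^U_{K(j,k)}=\sum_{l=j+1}^{k-1}\beta\left(\frac{\tilde F(P_eX_{(l)})-\tilde F(P_eX_{(j)})}{\tilde F(P_eX_{(k)})-\tilde F(P_eX_{(j)})}\right),$$ where, with $K_N=\{x\in K:0<P_ex\le P_eX_{(N)}\}$ and $X$ with density $f$ independent of the sample, $\tilde F(z)=\mathbb P(P_eX\le z\mid N,X\in K_N,X_{(N)})$ (so $\tilde F(0)=0$). For the wedge $K^i$ the quantities $N,P_e,\tilde F,X_{(j)}$ are those belonging to $K^i$, and $N^i$ is the number of observations in $K^i$. Critical values.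 $\overline\kappa_n(\alpha)$ is the $(1-\alpha)$-quantile of the conditional distribution, given $N^1,\dots,N^{L_n}$, of $$\max_{i=1,\dots,L_n}\ \max_{0\le j_i<k_i\le N^i,\,k_i-j_i>1}\Big(\sqrt{\tfrac{3}{k_i-j_i-1}}\,|T^U_{K^i(j_i,k_i)}|-\Gamma\big(\tfrac{k_i-j_i}{n-1}\big)\Big),$$ and $\overline c_{K^i(j_i,k_i)}(\alpha)=\sqrt{\frac{k_i-j_i-1}{3}}\big(\overline\kappa_n(\alpha)+\Gamma(\frac{k_i-j_i}{n-1})\big)$. *)

(* Defs.v *)
From HB Require Import structures.
From mathcomp Require Import all_boot all_order all_algebra.
From mathcomp Require Import all_classical all_reals all_analysis.

Set Implicit Arguments.
Unset Strict Implicit.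
Unset Printing Implicit Defensive.

Import Order.TTheory GRing.Theory Num.Theory.
Import numFieldNormedType.Exports.

Local Open Scope classical_set_scope.
Local Open Scope ring_scope.

(* The Borel sigma-algebra of R^d, as the one generated by the coordinates. *)
Definition rV_display : measure_display -> measure_display.
Proof. exact. Qed.

Section measurable_rV.
Context {disp : measure_display} {T : measurableType disp} {d : nat}.

Definition rV_coord (i : 'I_d) (x : 'rV[T]_d) : T := x ord0 i.

Let rV_set0 : g_sigma_preimage rV_coord set0.
Proof. exact: sigma_algebra0. Qed.

Let rV_setC A : g_sigma_preimage rV_coord A -> g_sigma_preimage rV_coord (~` A).
Proof. exact: sigma_algebraC. Qed.

Let rV_bigcup (F : (set 'rV[T]_d)^nat) :
  (forall i, g_sigma_preimage rV_coord (F i)) ->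
  g_sigma_preimage rV_coord (\bigcup_i (F i)).
Proof. exact: sigma_algebra_bigcup. Qed.

HB.instance Definition _ := @isMeasurable.Build (rV_display disp)
  'rV[T]_d (g_sigma_preimage rV_coord) rV_set0 rV_setC rV_bigcup.

Lemma measurable_rV_coord (i : 'I_d) : measurable_fun [set: 'rV[T]_d] (rV_coord i).
Proof.
move=> _ Y mY; rewrite setTI; apply: sub_sigma_algebra => /=.
rewrite -bigcup_seq/=; exists i => /=; first by rewrite mem_index_enum.
by exists Y => //; rewrite setTI.
Qed.

Lemma measurable_fun_rVP disp' (T' : measurableType disp') (f : T' -> 'rV[T]_d) :
  (forall i, measurable_fun [set: T'] (rV_coord i \o f)) ->
  measurable_fun [set: T'] f.
Proof.
move=> mf _ Y; rewrite setTI.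
suff : g_sigma_preimage rV_coord `<=` [set A | measurable (f @^-1` A)] by apply.
apply: smallest_sub.
  split => /=.
  - by rewrite preimage_set0.
  - by move=> A mA; rewrite setTD preimage_setC; exact: measurableC.
  - by move=> F mF; rewrite preimage_bigcup; exact: bigcup_measurable.
rewrite -bigcup_seq; apply: bigcup_sub => i _ _ [B mB <-] /=.
by rewrite setTI -comp_preimage -[X in measurable X]setTI; exact: mf.
Qed.

End measurable_rV.

(* d-dimensional Lebesgue measure, as the d-fold product of [lebesgue_measure]. *)
Section lebesgue_rV.
Context {R : realType}.

Definition rV_cons {d} (p : measurableTypeR R * 'rV[R]_d) : 'rV[R]_d.+1 :=
  \row_j (if unlift ord0 j is Some k then p.2 ord0 k else p.1).

Definition rV_uncons {d} (x : 'rV[R]_d.+1) : measurableTypeR R * 'rV[R]_d :=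
  (x ord0 ord0, \row_j x ord0 (lift ord0 j)).

Lemma rV_consK {d} : cancel (@rV_cons d) rV_uncons.
Proof.
move=> [a v]; rewrite /rV_uncons mxE unlift_none; congr pair.
by apply/rowP => j; rewrite !mxE liftK.
Qed.

Lemma measurable_rV_cons {d} : measurable_fun [set: _] (@rV_cons d).
Proof.
apply: measurable_fun_rVP => i; case: (unliftP ord0 i) => [k|] ->.
  rewrite (_ : _ \o _ = rV_coord k \o snd); last first.
    by apply/funext => p; rewrite /= /rV_coord mxE liftK.
  exact: (measurableT_comp (measurable_rV_coord k) measurable_snd).
rewrite (_ : _ \o _ = fst); first exact: measurable_fst.
by apply/funext => p; rewrite /= /rV_coord mxE unlift_none.
Qed.

HB.instance Definition _ {d} :=
  isMeasurableFun.Build _ _ _ _ (@rV_cons d) measurable_rV_cons.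

Lemma measurable_rV_uncons {d} : measurable_fun [set: _] (@rV_uncons d).
Proof.
apply/measurable_fun_pairP; split; first exact: (measurable_rV_coord ord0).
apply: measurable_fun_rVP => i.
rewrite (_ : _ \o _ = rV_coord (lift ord0 i)); first exact: measurable_rV_coord.
by apply/funext => p; rewrite /= /rV_coord mxE.
Qed.

Section step.
Context {d : nat} (mu : {sigma_finite_measure set 'rV[R]_d -> \bar R}).

Definition lebesgue_rVS : set 'rV[R]_d.+1 -> \bar R :=
  pushforward (@lebesgue_measure R \x mu)%E rV_cons.

Let lebesgue_rVS0 : lebesgue_rVS set0 = 0%E.
Proof. exact: measure0. Qed.

Let lebesgue_rVS_ge0 A : (0 <= lebesgue_rVS A)%E.
Proof. exact: measure_ge0. Qed.

Let lebesgue_rVS_sigma_additive : semi_sigma_additive lebesgue_rVS.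
Proof. exact: measure_semi_sigma_additive. Qed.

HB.instance Definition _ := isMeasure.Build _ _ _ lebesgue_rVS
  lebesgue_rVS0 lebesgue_rVS_ge0 lebesgue_rVS_sigma_additive.

Let sigma_finite_lebesgue_rVS : sigma_finite setT lebesgue_rVS.
Proof.
have /sigma_finiteP[F [FT ndF mF]] := sigma_finiteT (@lebesgue_measure R).
have /sigma_finiteP[G [GT ndG mG]] := sigma_finiteT mu.
exists (fun i => rV_uncons @^-1` (F i `*` G i)).
  apply/esym; rewrite -subTset => x _.
  have : (\bigcup_i F i) (rV_uncons x).1 by rewrite -FT.
  have : (\bigcup_i G i) (rV_uncons x).2 by rewrite -GT.
  move=> -[k _ Gk] [l _ Fl]; exists (maxn k l) => //; split.
    by move: Fl; exact/subsetPset/ndF/leq_maxr.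
  by move: Gk; exact/subsetPset/ndG/leq_maxl.
move=> i; have [mFi Fi] := mF i; have [mGi Gi] := mG i; split.
  by rewrite -[X in measurable X]setTI; apply: measurable_rV_uncons => //; exact: measurableX.
rewrite /lebesgue_rVS /pushforward -comp_preimage.
rewrite (_ : rV_uncons \o rV_cons = id); last by apply/funext => p /=; rewrite rV_consK.
by rewrite preimage_id product_measure1E// lte_mul_pinfty// ge0_fin_numE.
Qed.

HB.instance Definition _ := Measure_isSigmaFinite.Build _ _ _ lebesgue_rVS
  sigma_finite_lebesgue_rVS.

End step.

Fixpoint lebesgue_rV (d : nat) : {sigma_finite_measure set 'rV[R]_d -> \bar R} :=
  if d is d'.+1 then lebesgue_rVS (lebesgue_rV d') else dirac (0 : 'rV[R]_0).

End lebesgue_rV.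

(* The library norm on ['rV_d] is the sup norm, hence [enorm]. *)
Section euclidean.
Context {R : realType} {d : nat}.
Implicit Types u v e : 'rV[R]_d.

Definition dot u v : R := \sum_(i < d) u ord0 i * v ord0 i.
Definition enorm u : R := Num.sqrt (dot u u).
Definition unit_vector e : Prop := enorm e = 1.
Definition angle u v : R := acos (dot u v / (enorm u * enorm v)).

(* The rows of [B] form an orthonormal basis of (span e)^\perp; the row space
   of [kermx e^T] is the set of all u with <u, e> = 0. *)
Definition orthonormal_basis_perp e (B : 'M[R]_(d.-1, d)) : Prop :=
  (forall i j, dot (row i B) (row j B) = (i == j)%:R) /\ (B == kermx e^T)%MS.

End euclidean.

Section density.
Context {R : realType} {d : nat}.
Context {disp : measure_display} {T : measurableType disp} {P : probability T R}.

Definition has_density (X : {RV P >-> 'rV[R]_d}) (f : 'rV[R]_d -> R) : Prop :=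
  [/\ measurable_fun [set: 'rV[R]_d] f, forall x, 0 <= f x &
      forall A, measurable A ->
        distribution P X A = (\int[lebesgue_rV d]_(x in A) (f x)%:E)%E].

Definition mutually_independent (n : nat) (X : 'I_n -> {RV P >-> 'rV[R]_d}) : Prop :=
  forall (J : {set 'I_n}) (A : 'I_n -> set 'rV[R]_d),
    (forall i, measurable (A i)) ->
    P (\bigcap_(i in [set i | i \in J]) (X i @^-1` A i)) =
    (\prod_(i in J) P (X i @^-1` A i))%E.

End density.

Record wedge_shape (R : realType) (d : nat) := Wedge {
  wvertex : 'rV[R]_d ;
  wdir : 'rV[R]_d ;
  wbasis : 'M[R]_(d.-1, d) ;
  wlength : R ;
  wangle : R }.

Section wedge.
Context {R : realType} {d : nat}.
Implicit Types (K : wedge_shape R d) (f : 'rV[R]_d -> R) (x : 'rV[R]_d).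

Definition wproj K x : R := dot (x - wvertex K) (wdir K).

Definition wset K : set 'rV[R]_d :=
  [set x | 0 < wproj K x <= wlength K /\
    forall i, - (tan (wangle K) * wproj K x)
                <= dot (x - wvertex K) (row i (wbasis K))
                <= tan (wangle K) * wproj K x].

Section sample.
Context {n : nat}.
Implicit Type X : 'I_n -> 'rV[R]_d.

Definition observations K X : seq 'rV[R]_d :=
  sort (fun x y => wproj K x <= wproj K y)
    [seq X i | i <- enum 'I_n & X i \in wset K].

Definition obs_count K X : nat := size (observations K X).

(* X_(j), with X_(0) the vertex *)
Definition order_stat K X (j : nat) : 'rV[R]_d :=
  nth (wvertex K) (wvertex K :: observations K X) j.

Definition proj_stat K X (j : nat) : R := wproj K (order_stat K X j).

Definition subsection K X (j k : nat) : set 'rV[R]_d :=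
  [set x | wset K x /\ proj_stat K X j < wproj K x <= proj_stat K X k].

End sample.

Definition increasing_on f (x0 : 'rV[R]_d) (A : set 'rV[R]_d) : Prop :=
  forall (e0 : 'rV[R]_d) (t1 t2 : R), unit_vector e0 -> 0 <= t1 -> t1 < t2 ->
    A (x0 + t1 *: e0) -> A (x0 + t2 *: e0) ->
    f (x0 + t1 *: e0) <= f (x0 + t2 *: e0).

Definition decreasing_on f (x0 : 'rV[R]_d) (A : set 'rV[R]_d) : Prop :=
  forall (e0 : 'rV[R]_d) (t1 t2 : R), unit_vector e0 -> 0 <= t1 -> t1 < t2 ->
    A (x0 + t1 *: e0) -> A (x0 + t2 *: e0) ->
    f (x0 + t2 *: e0) <= f (x0 + t1 *: e0).

End wedge.

Section statistics.
Context {R : realType} {d n : nat}.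
Implicit Types (K : wedge_shape R d) (f : 'rV[R]_d -> R) (X : 'I_n -> 'rV[R]_d).

Definition beta_kernel (z : R) : R := if 0 < z < 1 then 2 * z - 1 else 0.

Definition Gamma_pen (delta : R) : R := Num.sqrt (2 * ln (expR 1 / delta)).

Definition T_stat K X (j k : nat) : R :=
  \sum_(j.+1 <= l < k)
    beta_kernel ((proj_stat K X l ^+ d - proj_stat K X j ^+ d) /
                 (proj_stat K X k ^+ d - proj_stat K X j ^+ d)).

(* K_N *)
Definition observed_part K X : set 'rV[R]_d :=
  [set x | wset K x /\ 0 < wproj K x <= proj_stat K X (obs_count K X)].

(* P(P_e Y <= z | N, Y \in K_N, X_(N)) for Y with density f independent of the
   sample: by independence, the sample only enters through the set K_N. *)
Definition F_tilde f K X (z : R) : R :=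
  fine (\int[lebesgue_rV d]_(x in observed_part K X `&` [set x | (wproj K x <= z)%R]) (f x)%:E)%E /
  fine (\int[lebesgue_rV d]_(x in observed_part K X) (f x)%:E)%E.

Definition TU_stat f K X (j k : nat) : R :=
  let F j := F_tilde f K X (proj_stat K X j) in
  \sum_(j.+1 <= l < k) beta_kernel ((F l - F j) / (F k - F j)).

Definition penalty (j k : nat) : R := Gamma_pen ((k - j)%:R / n.-1%:R).

Definition admissible K X (j k : nat) : bool :=
  (j < k <= obs_count K X)%N && (1 < k - j)%N.

(* -oo if no wedge has an admissible pair (j, k) *)
Definition max_stat (I : finType) f (Ks : I -> wedge_shape R d) X : \bar R :=
  (\big[maxe/-oo]_(i : I)
   \big[maxe/-oo]_(j < (obs_count (Ks i) X).+1)
   \big[maxe/-oo]_(k < (obs_count (Ks i) X).+1 | admissible (Ks i) X j k)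
     (Num.sqrt (3 / (k - j - 1)%:R) * `|TU_stat f (Ks i) X j k| - penalty j k)%:E)%E.

Definition obs_counts (I : finType) (Ks : I -> wedge_shape R d) X : {ffun I -> nat} :=
  [ffun i => obs_count (Ks i) X].

End statistics.

Section critical_values.
Context {R : realType} {d n : nat} {I : finType}.
Context {disp : measure_display} {T : measurableType disp} {P : probability T R}.
Context (f : 'rV[R]_d -> R) (Ks : I -> wedge_shape R d) (X : 'I_n -> {RV P >-> 'rV[R]_d}).

Definition sample (w : T) : 'I_n -> 'rV[R]_d := fun i => X i w.

(* P(max_stat <= t | (N^i)_i = m); 0 if P((N^i)_i = m) = 0 *)
Definition cond_cdf (m : {ffun I -> nat}) (t : R) : R :=
  fine (P [set w | obs_counts Ks (sample w) = m /\
                   (max_stat f Ks (sample w) <= t%:E)%E]) /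
  fine (P [set w | obs_counts Ks (sample w) = m]).

Definition kappa (alpha : R) (m : {ffun I -> nat}) : \bar R :=
  ereal_inf [set t%:E | t in [set t : R | 1 - alpha <= cond_cdf m t]].

Definition critical_value (alpha : R) (w : T) (j k : nat) : \bar R :=
  ((Num.sqrt ((k - j - 1)%:R / 3))%:E *
   (kappa alpha (obs_counts Ks (sample w)) + (penalty (n := n) j k)%:E))%E.

End critical_values.

Section family.
Context {R : realType}.

Definition scale_l (d n : nat) : R := (ln n%:R / n%:R) `^ (d + 4)%:R^-1.

Definition family_length (d n : nat) (C1 : R) : R := C1 * ln n%:R * scale_l d n.

Definition family_angle (n : nat) (C2 : R) : R := C2 / 2 * (ln n%:R)^-1.

Definition grid_step (d n : nat) (C1 eps : R) : R := (2 + eps) * family_length d n C1.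

Definition grid_size (d n : nat) (C1 eps : R) : nat :=
  `|Num.ceil (2 * n%:R / grid_step d n C1 eps)|%N.

Definition grid_vertex (d n : nat) (C1 eps : R)
    (i : {ffun 'I_d -> 'I_(grid_size d n C1 eps).+1}) : 'rV[R]_d :=
  \row_j ((i j)%:R * grid_step d n C1 eps - n%:R).

Definition separation (d n : nat) (C2 eps : R) : R :=
  (2 + eps) * atan (Num.sqrt d.-1%:R * tan (family_angle n C2)).

(* A possible outcome of the greedy choice of directions. If d = 1 the required
   separation is 0, so that the choice never stops; then any finite number of
   steps is accepted. *)
Definition greedy_directions (d : nat) (sep : R) (M : nat) (e : 'I_M -> 'rV[R]_d) : Prop :=
  [/\ (0 < M)%N,
      forall i, unit_vector (e i),
      forall i j : 'I_M, (j < i)%N -> sep <= `|angle (e i) (e j)| &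
      (1 < d)%N ->
        ~ exists u, unit_vector u /\ forall j, sep <= `|angle u (e j)|].

(* [B x0 e] is the basis of (span e)^\perp fixed for the vertex x0. *)
Definition wedge_family (d n : nat) (C1 C2 eps : R) (M : nat) (e : 'I_M -> 'rV[R]_d)
    (B : 'rV[R]_d -> 'rV[R]_d -> 'M[R]_(d.-1, d))
    (i : {ffun 'I_d -> 'I_(grid_size d n C1 eps).+1} * 'I_M) : wedge_shape R d :=
  let x0 := grid_vertex i.1 in
  Wedge x0 (e i.2) (B x0 (e i.2)) (family_length d n C1) (family_angle n C2).

End family.

Arguments wedge_family {R} d n C1 C2 eps {M} e B i.

(* Main.v *)
From HB Require Import structures.
Require Import Defs.
From mathcomp Require Import all_boot all_order all_algebra.
From mathcomp Require Import all_classical all_reals all_analysis.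
From mathcomp Require Import measurable_realfun ring lra.

(* If f increases along the rays from the vertex x0, then dilating a shell
   {x in K : a < P x <= b} by a factor s >= 1 multiplies its mass by at least s^d.
   Cutting into shells between consecutive points of a geometric progression and
   refining it, one finds that the mass H(z) of {x in K : P x <= z} is a convex function
   of z^d. Almost surely the values H(P X_(l)) are distinct, so the normalised spacings
   in T^U lie in (0,1) and are at most those in T, whence T^U <= T; in the decreasing
   case the inequality is reversed. A false rejection therefore forces the
   maximum statistic above its conditional quantile, given the counts N^i, and this has
   conditional probability at most alpha. *)

(** [T_stat] is what [TU_stat] becomes for a density constant on the wedge: the mass of {P x <= z}
    is then proportional to z^d, d being also the exponent with which a dilation rescales volume.
    This is why convexity is measured in z^d and why dilations about the vertex exploit monotonicity
    along rays. Distinct masses are essential because [beta_kernel] is not monotone on [0,1]: it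
    drops from 0 to nearly -1 just after 0, and from nearly 1 to 0 at 1. Distinct projections P
    X_(l) would not be enough, since H may be flat where [f] vanishes; but flat stretches carry no
    mass, so almost surely no observation of the wedge falls strictly inside one. The quantile is an
    infimum in the extended reals, so it is approached by a sequence of thresholds instead of being
    assumed attained. *)

Set Implicit Arguments.
Unset Strict Implicit.
Unset Printing Implicit Defensive.

Import Order.TTheory GRing.Theory Num.Theory.
Import numFieldNormedType.Exports.

Local Open Scope classical_set_scope.
Local Open Scope ring_scope.

(** * Lebesgue measure on R^d under dilations *)

(* The measure structure of the library on [pushforward m f] does not infer the
   measurability of [f]. *)
Definition image_measure d d' (T : measurableType d) (T' : measurableType d')
    (R : realFieldType) (m : {measure set T -> \bar R}) (f : T -> T')
    (mf : measurable_fun [set: T] f) : {measure set T' -> \bar R}.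
Proof. by refine (pushforward m f); exact: mf. Defined.

Section affine_maps.
Context {R : realType}.

Definition affine (s c x : measurableTypeR R) : measurableTypeR R := s * x + c.

Lemma measurable_affine s c : measurable_fun [set: _] (affine s c).
Proof. by apply: measurable_funD => //; exact: measurable_funM. Qed.

HB.instance Definition _ s c :=
  isMeasurableFun.Build _ _ _ _ (affine s c) (@measurable_affine s c).

(** As a function of [A] the right-hand side is again a measure, so uniqueness of Lebesgue measure
    leaves only half-open intervals to check. The sign of [s] is bundled because [mscale] takes a
    nonnegative factor. *)
Lemma lebesgue_measure_affine (s : {nonneg R}) (c : R) (A : set R) :
  0 < s%:num -> measurable A ->
  lebesgue_measure A =
  (s%:num%:E * lebesgue_measure ((affine s%:num c) @^-1` A))%E.
Proof.
move=> s0 mA.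
rewrite -[RHS]/(mscale s (image_measure lebesgue_measure (measurable_affine s%:num c)) A).
apply: lebesgue_measure_unique => //= _ [[a b]] _ <-.
rewrite /mscale/= /pushforward.
rewrite (_ : _ @^-1` _ = `](a - c) / s%:num, (b - c) / s%:num]%classic); last first.
  apply/seteqP; split => x /=; rewrite !in_itv/= /affine
    ltr_pdivrMr// ler_pdivlMr//= (mulrC x) -ltrBlDr -lerBrDr//.
rewrite !lebesgue_measure_itv/= !lte_fin ltr_pM2r ?invr_gt0// ltrD2r.
case: ifP => ab; last by rewrite mule0.
by rewrite -!EFinD -EFinM; congr EFin; field; rewrite gt_eqF.
Qed.

Context {d : nat}.
Definition affine_rV (s : R) (c x : 'rV[R]_d) : 'rV[R]_d := s *: x + c.

Lemma measurable_affine_rV s c : measurable_fun [set: _] (affine_rV s c).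
Proof.
apply: measurable_fun_rVP => i.
rewrite (_ : _ \o _ = affine s (c ord0 i) \o rV_coord i).
  exact: measurableT_comp (measurable_affine _ _) (measurable_rV_coord i).
by apply/funext => x /=; rewrite /rV_coord !mxE.
Qed.

HB.instance Definition _ s c :=
  isMeasurableFun.Build _ _ _ _ (affine_rV s c) (@measurable_affine_rV s c).

End affine_maps.

Section lebesgue_rV_theory.
Context {R : realType}.

Lemma lebesgue_rVSE d (mu : {sigma_finite_measure set 'rV[R]_d -> \bar R}) A :
  lebesgue_rVS mu A = (lebesgue_measure \x mu)%E (rV_cons @^-1` A).
Proof. by []. Qed.

(** The map acts on each coordinate separately, so through [rV_cons] it becomes a product map, and
    uniqueness of the product measure reduces the claim to rectangles: one factor [s] from the line,
    [s ^+ d] from the induction. *)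
Lemma lebesgue_rV_affine d (s : {nonneg R}) (c : 'rV[R]_d) (A : set 'rV[R]_d) :
  0 < s%:num -> measurable A ->
  lebesgue_rV d A = ((s%:num ^+ d)%:E * lebesgue_rV d (affine_rV s%:num c @^-1` A))%E.
Proof.
move=> s0; elim: d c A => [|d IHd] c A mA.
  rewrite expr0 mul1e /= !diracE; congr (_%:R%:E).
  suff -> : affine_rV s%:num c @^-1` A = A by [].
  by apply/seteqP; split => x /=; rewrite /affine_rV (_ : _ + c = x) //;
    apply/rowP; case.
rewrite /= !lebesgue_rVSE.
pose c' : 'rV[R]_d := \row_j c ord0 (lift ord0 j).
pose phi (p : measurableTypeR R * 'rV[R]_d) : measurableTypeR R * 'rV[R]_d :=
  (affine s%:num (c ord0 ord0) p.1, affine_rV s%:num c' p.2).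
have mphi : measurable_fun [set: _] phi.
  apply/measurable_fun_pairP; split.
    exact: measurableT_comp (measurable_affine _ _) measurable_fst.
  exact: measurableT_comp (measurable_affine_rV _ _) measurable_snd.
have consE p : affine_rV s%:num c (rV_cons p) = rV_cons (phi p).
  apply/rowP => j; rewrite !mxE /=; case: unliftP => [k|] -> //.
  by rewrite !mxE.
have phiE : rV_cons @^-1` (affine_rV s%:num c @^-1` A) = phi @^-1` (rV_cons @^-1` A).
  by apply/seteqP; split => p /=; rewrite consE.
rewrite phiE; have sd0 : 0 <= s%:num ^+ d.+1 by exact: exprn_ge0.
pose sd := NngNum sd0.
rewrite -[RHS]/(mscale sd (image_measure (lebesgue_measure \x lebesgue_rV d)%E mphi)
  (rV_cons @^-1` A)).
apply: product_measure_unique; last first.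
  by rewrite -[X in measurable X]setTI; exact: measurable_rV_cons.
move=> A1 A2 mA1 mA2 /=; rewrite /mscale/= /pushforward.
rewrite (_ : phi @^-1` _ =
  (affine s%:num (c ord0 ord0) @^-1` A1) `*` (affine_rV s%:num c' @^-1` A2)) //.
rewrite product_measure1E//; last 2 first.
- by rewrite -[X in measurable X]setTI; exact: measurable_affine.
- by rewrite -[X in measurable X]setTI; exact: measurable_affine_rV.
rewrite [X in _ = (X * _)%E](lebesgue_measure_affine (c ord0 ord0) s0 mA1).
rewrite [X in _ = (_ * X)%E](IHd c' _ mA2) exprS EFinM.
by rewrite muleACA.
Qed.

Lemma measurable_dot d (e : 'rV[R]_d) : measurable_fun [set: _] (dot^~ e).
Proof.
apply: measurable_sum => i; apply: measurable_funM => //.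
exact: measurable_rV_coord.
Qed.

(** Fubini and induction. If the normal has a nonzero tail, every section over the first coordinate
    is a hyperplane one dimension lower; otherwise the set sits over a single value of the first
    coordinate. *)
Lemma lebesgue_rV_hyperplane d (e : 'rV[R]_d) (c : R) :
  e != 0 -> lebesgue_rV d [set x | dot x e = c] = 0%E.
Proof.
elim: d e c => [|d IHd] e c; first by rewrite (_ : e = 0) ?eqxx//; apply/rowP; case.
move=> e0; rewrite /= lebesgue_rVSE.
pose e' : 'rV[R]_d := \row_j e ord0 (lift ord0 j).
have dotE (p : measurableTypeR R * 'rV[R]_d) :
    dot (rV_cons p) e = p.1 * e ord0 ord0 + dot p.2 e'.
  rewrite /dot big_ord_recl /rV_cons mxE unlift_none; congr (_ + _).
  by apply: eq_bigr => i _; rewrite !mxE liftK.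
have [e'0|e'0] := eqVneq e' 0; last first.
  rewrite /product_measure1/= integral0_eq// => x _ /=.
  rewrite (_ : xsection _ x = [set y | dot y e' = c - x * e ord0 ord0]) ?IHd//.
  apply/seteqP; split => y; rewrite /xsection/= inE/= dotE/=.
    by move=> <-; rewrite addrC addKr.
  by move=> ->; rewrite addrC subrK.
have e00 : e ord0 ord0 != 0.
  apply: contra_neq e0 => e00; apply/rowP => j; rewrite mxE.
  case: (unliftP ord0 j) => [k|] -> //.
  by have /rowP/(_ k) := e'0; rewrite !mxE.
apply/eqP; rewrite -measure_le0.
rewrite (_ : 0 = (lebesgue_measure \x lebesgue_rV d) ([set (c / e ord0 ord0)%R] `*` setT))%E.
  apply: le_measure; rewrite ?inE.
  - rewrite -[X in measurable X]setTI.
    apply: measurable_rV_cons => //.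
    rewrite -[X in measurable X]setTI.
    exact: (measurable_dot e measurableT (measurable_set1 c)).
  - exact: measurableX.
  - move=> p /=; rewrite dotE e'0 => <-; split => //=.
    rewrite [dot _ _]big1 ?addr0 ?mulfK// => i _.
    by rewrite mxE mulr0.
by rewrite product_measure1E// [X in (X * _)%E]lebesgue_measure_set1 mul0e.
Qed.

End lebesgue_rV_theory.

(** * Measurability and geometry of wedges *)

Section measurable_predicates.
Context d (T : measurableType d).

Lemma measurable_set_bool (b : T -> bool) :
  measurable_fun [set: T] b -> measurable [set x | b x].
Proof.
move=> mb; rewrite (_ : [set x | b x] = [set: T] `&` b @^-1` [set true]); first exact: mb.
by rewrite setTI.
Qed.

Lemma measurable_exists (I : countType) (A : I -> set T) :
  (forall i, measurable (A i)) -> measurable [set x | exists i, A i x].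
Proof.
move=> mA; rewrite (_ : mkset _ = \bigcup_i A i); first exact: countable_bigcupT_measurable.
by apply/seteqP; split => x [i]; [exists i|move=> _; exists i].
Qed.

Lemma measurable_forall (I : countType) (A : I -> set T) :
  (forall i, measurable (A i)) -> measurable [set x | forall i, A i x].
Proof.
move=> mA; rewrite (_ : mkset _ = ~` [set x | exists i, (~` A i) x]).
  by apply: measurableC; apply: measurable_exists => i; exact: measurableC.
apply/seteqP; split => x /=; first by move=> Ax [i]; apply.
by move=> /forallNP Ax i; exact: contrapT (Ax i).
Qed.

Lemma measurable_Prop (p : Prop) : measurable [set _ : T | p].
Proof.
have [hp|hp] := pselect p; [rewrite (_ : mkset _ = setT)//|rewrite (_ : mkset _ = set0)//];
  by apply/seteqP; split.
Qed.

End measurable_predicates.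

Section wedge_geometry.
Context {R : realType} {d : nat}.
Implicit Types (K : wedge_shape R d) (x : 'rV[R]_d).

Lemma dotZl a (u v : 'rV[R]_d) : dot (a *: u) v = a * dot u v.
Proof. by rewrite /dot mulr_sumr; apply: eq_bigr => i _; rewrite mxE mulrA. Qed.

Lemma dotBl (u v w : 'rV[R]_d) : dot (u - v) w = dot u w - dot v w.
Proof. by rewrite /dot -sumrB; apply: eq_bigr => i _; rewrite !mxE mulrBl. Qed.

Lemma dot_ge0 (u : 'rV[R]_d) : 0 <= dot u u.
Proof. by apply: sumr_ge0 => i _; rewrite -expr2 sqr_ge0. Qed.

Lemma enormZ a (u : 'rV[R]_d) : 0 <= a -> enorm (a *: u) = a * enorm u.
Proof.
move=> a0; rewrite /enorm (_ : dot _ _ = a ^+ 2 * dot u u); last first.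
  by rewrite /dot mulr_sumr; apply: eq_bigr => i _; rewrite mxE; ring.
by rewrite sqrtrM ?sqr_ge0// sqrtr_sqr ger0_norm.
Qed.

Lemma enorm_gt0 (u : 'rV[R]_d) : u != 0 -> 0 < enorm u.
Proof.
move=> u0; rewrite /enorm sqrtr_gt0 lt_neqAle dot_ge0 andbT eq_sym.
apply: contra_neq u0 => /eqP; rewrite psumr_eq0; last by move=> i _; rewrite -expr2 sqr_ge0.
move=> /allP u0; apply/rowP => i; rewrite mxE; apply/eqP.
by have := u0 i (mem_index_enum _); rewrite /= mulf_eq0 orbb.
Qed.

Lemma unit_vector_neq0 (u : 'rV[R]_d) : unit_vector u -> u != 0.
Proof.
apply: contra_eq_neq => ->.
by rewrite /enorm /dot big1 ?sqrtr0 1?eq_sym ?oner_eq0// => i _; rewrite mxE mul0r.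
Qed.

Lemma measurable_wproj K : measurable_fun [set: 'rV[R]_d] (wproj K).
Proof.
rewrite (_ : wproj K = (dot^~ (wdir K)) \- cst (dot (wvertex K) (wdir K))).
  by apply: measurable_funB => //; exact: measurable_dot.
by apply/funext => x /=; rewrite -dotBl.
Qed.

Definition dilation K (s : R) : 'rV[R]_d -> 'rV[R]_d :=
  affine_rV s ((1 - s) *: wvertex K).

Lemma dilationE K s x : dilation K s x = wvertex K + s *: (x - wvertex K).
Proof.
by rewrite /dilation /affine_rV scalerBl scale1r scalerBr addrCA addrC -addrA addrC.
Qed.

Lemma dilationB K s x : dilation K s x - wvertex K = s *: (x - wvertex K).
Proof. by rewrite dilationE addrAC subrr add0r. Qed.

Lemma wproj_dilation K s x : wproj K (dilation K s x) = s * wproj K x.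
Proof. by rewrite /wproj dilationB dotZl. Qed.

Definition shell K (a b : R) : set 'rV[R]_d :=
  [set x | wset K x /\ a < wproj K x <= b].

Lemma measurable_wset K : measurable (wset K).
Proof.
pose D i := fun x => dot (x - wvertex K) (row i (wbasis K)).
have mD i : measurable_fun [set: 'rV[R]_d] (D i).
  rewrite (_ : D i = (dot^~ (row i (wbasis K))) \- cst (dot (wvertex K) (row i (wbasis K)))).
    by apply: measurable_funB => //; exact: measurable_dot.
  by apply/funext => x /=; rewrite -dotBl.
have mt : measurable_fun [set: 'rV[R]_d] (fun x => tan (wangle K) * wproj K x).
  by apply: measurable_funM => //; exact: measurable_wproj.
apply: measurableI.
  apply: measurable_set_bool; apply: measurable_and.
    by apply: measurable_fun_ltr => //; exact: measurable_wproj.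
  by apply: measurable_fun_ler => //; exact: measurable_wproj.
apply: measurable_forall => i; apply: measurable_set_bool; apply: measurable_and.
  by apply: measurable_fun_ler; [exact: measurableT_comp mt|exact: mD].
by apply: measurable_fun_ler; [exact: mD|exact: mt].
Qed.

Lemma measurable_shell K a b : measurable (shell K a b).
Proof.
apply: measurableI; first exact: measurable_wset.
apply: measurable_set_bool; apply: measurable_and.
  by apply: measurable_fun_ltr => //; exact: measurable_wproj.
by apply: measurable_fun_ler => //; exact: measurable_wproj.
Qed.

(** The cone condition is homogeneous about the vertex; only the truncation at the wedge length is
    not, whence the bounds on both [b] and [s * b]. *)
Lemma dilation_shell K s a b : 0 < s -> 0 <= b -> s * b <= Defs.wlength K -> b <= Defs.wlength K ->
  dilation K s @^-1` shell K (s * a) (s * b) = shell K a b.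
Proof.
move=> s0 b0 sbl bl; apply/seteqP; split => x; rewrite /shell/= /wset/= wproj_dilation;
    rewrite !ltr_pM2l// !ler_pM2l//.
- move=> [[/andP[x0 xl] xK] /andP[ax xb]]; split; last by rewrite ax.
  rewrite pmulr_rgt0// in x0; split; first by rewrite x0 (le_trans xb).
  by move=> i; move: (xK i); rewrite dilationB dotZl mulrCA -mulrN !ler_pM2l.
- move=> [[/andP[x0 xl] xK] /andP[ax xb]]; split; last by rewrite ax.
  split; first by rewrite mulr_gt0//= (le_trans _ sbl)// ler_pM2l.
  by move=> i; rewrite dilationB dotZl mulrCA -mulrN !ler_pM2l.
Qed.

(** The point and its dilate lie on one ray, at distances [r] and [s * r] from the vertex. The case
    s = 1 escapes the strict inequality in [increasing_on] and is treated apart. *)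
Lemma increasing_on_dilation K f (A : set 'rV[R]_d) s x :
  increasing_on f (wvertex K) A -> 1 <= s -> x != wvertex K ->
  A x -> A (dilation K s x) -> f x <= f (dilation K s x).
Proof.
move=> incf s1 xK Ax Asx; pose r := enorm (x - wvertex K).
have r0 : 0 < r by rewrite enorm_gt0// subr_eq0.
pose u := r^-1 *: (x - wvertex K).
have xE : x = wvertex K + r *: u by rewrite /u scalerA mulfV ?gt_eqF// scale1r addrC subrK.
have sxE : dilation K s x = wvertex K + (s * r) *: u.
  by rewrite dilationE {1}xE (addrC _ (r *: u)) addrK scalerA.
move: s1; rewrite le_eqVlt => /predU1P[s1|s1]; first by rewrite sxE -s1 mul1r -xE.
rewrite sxE {1}xE; apply: incf; rewrite -?xE -?sxE//.
- by rewrite /unit_vector enormZ ?invr_ge0 ?ltW// mulVf// gt_eqF.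
- exact: ltW.
- by rewrite -{1}(mul1r r) ltr_pM2r.
Qed.

Lemma decreasing_onN f (x0 : 'rV[R]_d) A :
  decreasing_on f x0 A -> increasing_on (fun x => - f x) x0 A.
Proof. by move=> decf e0 t1 t2 ? ? ? ? ?; rewrite lerN2; exact: decf. Qed.

End wedge_geometry.

(** * Mass of wedge shells and its growth under dilations *)

Definition density {R : realType} {d : nat} (nu : set 'rV[R]_d -> \bar R)
    (f : 'rV[R]_d -> R) : Prop :=
  [/\ measurable_fun [set: 'rV[R]_d] f, forall x, 0 <= f x &
      forall A, measurable A -> nu A = (\int[lebesgue_rV d]_(x in A) (f x)%:E)%E].

Lemma ge0_integral_dilation {R : realType} {d : nat} (K : wedge_shape R d) (s : R)
    (f : 'rV[R]_d -> R) (A : set 'rV[R]_d) :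
  0 < s -> measurable_fun [set: 'rV[R]_d] f -> (forall x, 0 <= f x) -> measurable A ->
  (\int[lebesgue_rV d]_(x in A) (f x)%:E =
   (s ^+ d)%:E * \int[lebesgue_rV d]_(x in dilation K s @^-1` A) (f (dilation K s x))%:E)%E.
Proof.
move=> s0 mf f0 mA; have mD := @measurable_affine_rV _ _ s ((1 - s) *: wvertex K).
pose s' := NngNum (ltW s0); have sd0 : 0 <= s ^+ d by apply: exprn_ge0; exact: ltW.
have mEf : measurable_fun A (EFin \o f) by apply/measurable_EFinP/measurable_funTS.
rewrite (eq_measure_integral (mscale (NngNum sd0) (image_measure (lebesgue_rV d) mD))).
  rewrite ge0_integral_mscale//=; last by move=> x _; rewrite lee_fin.
  by rewrite ge0_integral_pushforward//= => x _; rewrite lee_fin.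
by move=> B mB _; exact: (@lebesgue_rV_affine _ _ s').
Qed.

Section wedge_mass.
Context {R : realType} {d : nat} (nu : probability 'rV[R]_d R) (f : 'rV[R]_d -> R).
Hypothesis nuf : density nu f.
Implicit Types (K : wedge_shape R d).

(* The unnormalised [F_tilde]. *)
Definition wmass K (z : R) : R := fine (nu (wset K `&` [set x | wproj K x <= z])).

Lemma measurable_wset_le K z : measurable (wset K `&` [set x | wproj K x <= z]).
Proof.
apply: measurableI; first exact: measurable_wset.
by apply: measurable_set_bool; apply: measurable_fun_ler => //; exact: measurable_wproj.
Qed.

Lemma wmassE K z : (wmass K z)%:E = nu (wset K `&` [set x | wproj K x <= z]).
Proof. by rewrite fineK// fin_num_measure//; exact: measurable_wset_le. Qed.

Lemma wmass_shell K a b : a <= b -> nu (shell K a b) = (wmass K b - wmass K a)%:E.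
Proof.
move=> ab; rewrite EFinB [in RHS]wmassE (_ : _ `&` _ =
    shell K a b `|` (wset K `&` [set x | wproj K x <= a])).
  have mb := measurable_wset_le K a; have ms := measurable_shell K a b.
  have -> : nu (shell K a b `|` (wset K `&` [set x | wproj K x <= a])) =
      (nu (shell K a b) + (wmass K a)%:E)%E.
    rewrite wmassE measureU//.
    by apply/seteqP; split => x //= -[[_ /andP[ax _]] [_]]; rewrite leNgt ax.
  by rewrite addeK.
apply/seteqP; split => x; rewrite /shell/=.
  by move=> [Kx xb]; have [xa|ax] := leP (wproj K x) a; [right|left; rewrite xb].
move=> [[Kx /andP[_ xb]]|[Kx xa]]; split => //; exact: le_trans ab.
Qed.

Lemma wmass_homo K : {homo wmass K : a b / a <= b}.
Proof. by move=> a b ab; rewrite -subr_ge0 -lee_fin -wmass_shell. Qed.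

Lemma wmass_le0 K z : z <= 0 -> wmass K z = 0.
Proof.
move=> z0; rewrite /wmass (_ : _ `&` _ = set0) ?measure0//.
apply/seteqP; split => x //= -[[/andP[x0 _] _] xz].
by move: (lt_le_trans x0 (le_trans xz z0)); rewrite ltxx.
Qed.

Lemma density_hyperplane K c : wdir K != 0 -> nu [set x | wproj K x = c] = 0%E.
Proof.
move=> K0; have [mf f0 ->] := nuf; last first.
  rewrite -[X in measurable X]setTI.
  exact: measurable_wproj measurableT _ (measurable_set1 c).
apply: null_set_integral.
- rewrite -[X in measurable X]setTI.
  exact: measurable_wproj measurableT _ (measurable_set1 c).
- by apply/measurable_EFinP/measurable_funTS.
rewrite (_ : mkset _ = [set x | dot x (wdir K) = c + dot (wvertex K) (wdir K)]).
  exact: lebesgue_rV_hyperplane.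
by apply/seteqP; split => x /=; rewrite /wproj dotBl => /eqP; rewrite ?subr_eq => /eqP //;
  move=> ->; rewrite addrK.
Qed.

(* Change of variables along [dilation K s], which maps the shell between [x] and
   [y] onto the one between [s x] and [s y]. *)
Lemma wmass_dilation K s x y : 0 < s -> 0 <= y -> x <= y ->
    y <= Defs.wlength K -> s * y <= Defs.wlength K ->
  (wmass K (s * y) - wmass K (s * x))%:E =
  ((s ^+ d)%:E * \int[lebesgue_rV d]_(z in shell K x y) (f (dilation K s z))%:E)%E.
Proof.
move=> s0 y0 xy yl syl; have [mf f0 nuE] := nuf.
rewrite -wmass_shell ?ler_pM2l// nuE; last exact: measurable_shell.
rewrite (ge0_integral_dilation K s0)//; last exact: measurable_shell.
by rewrite dilation_shell.
Qed.

Lemma measurable_dilation K s : measurable_fun [set: 'rV[R]_d] (dilation K s).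
Proof. exact: measurable_affine_rV. Qed.

Section monotone_density.
Context (K : wedge_shape R d) (a b : R).
Hypotheses (a0 : 0 <= a) (bl : b <= Defs.wlength K).

Let shell_neq_vertex x y z : 0 <= x -> shell K x y z -> z != wvertex K.
Proof.
move=> x0 [_ /andP[xz _]]; apply: contraTN (le_lt_trans x0 xz) => /eqP ->.
by rewrite /wproj subrr /dot big1 ?ltxx// => i _; rewrite mxE mul0r.
Qed.

Let shell_sub x y s z : a <= x -> x <= y -> 1 <= s -> s * y <= b ->
  shell K x y z -> shell K a b z /\ shell K a b (dilation K s z).
Proof.
move=> ax xy s1 syb xyz; have s0 : 0 < s := lt_le_trans ltr01 s1.
have x0 := le_trans a0 ax; have y0 := le_trans x0 xy.
have ysy : y <= s * y by rewrite ler_peMl.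
have xsx : x <= s * x by rewrite ler_peMl.
have : shell K (s * x) (s * y) (dilation K s z).
  move: xyz; rewrite -(@dilation_shell _ _ K s)//; first exact: le_trans bl.
  by rewrite (le_trans ysy)// (le_trans syb).
move: xyz => [Kz /andP[xz zy]] [Ksz /andP[xsz szy]]; split; split => //.
  by rewrite (le_lt_trans ax)//= (le_trans zy)// (le_trans ysy).
by rewrite (le_trans szy syb) andbT (le_lt_trans _ xsz)// (le_trans ax).
Qed.

Let wmass_shellE x y : a <= x -> x <= y -> y <= b ->
  (wmass K y - wmass K x)%:E = (\int[lebesgue_rV d]_(z in shell K x y) (f z)%:E)%E.
Proof.
move=> ax xy yb; have [mf f0 nuE] := nuf.
by rewrite -wmass_shell// nuE//; exact: measurable_shell.
Qed.

(** After the change of variables both sides are [s ^+ d] times an integral over the shell between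
    [x] and [y], and the integrands compare pointwise. The bound [s * y <= b] keeps the dilates
    where monotonicity is known. *)
Lemma wmass_increasing x y s : increasing_on f (wvertex K) (shell K a b) ->
  a <= x -> x <= y -> 1 <= s -> s * y <= b ->
  s ^+ d * (wmass K y - wmass K x) <= wmass K (s * y) - wmass K (s * x).
Proof.
move=> incf ax xy s1 syb; have [mf f0 nuE] := nuf.
have s0 : 0 < s := lt_le_trans ltr01 s1.
have x0 := le_trans a0 ax; have y0 := le_trans x0 xy.
have ysy : y <= s * y by rewrite ler_peMl.
rewrite -lee_fin EFinM wmass_dilation//; try by rewrite (le_trans _ bl)// (le_trans ysy).
rewrite wmass_shellE//; last exact: le_trans syb.
rewrite lee_pmul2l// ?lte_fin ?exprn_gt0//.
apply: ge0_le_integral => //=.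
- exact: measurable_shell.
- by move=> z _; rewrite lee_fin.
- exact/measurable_EFinP/measurable_funTS.
- by apply/measurable_EFinP/measurable_funTS/measurableT_comp => //; exact: measurable_dilation.
move=> z xyz; rewrite lee_fin; have [Az Asz] := shell_sub ax xy s1 syb xyz.
exact: increasing_on_dilation incf s1 (shell_neq_vertex x0 xyz) Az Asz.
Qed.

Lemma wmass_decreasing x y s : decreasing_on f (wvertex K) (shell K a b) ->
  a <= x -> x <= y -> 1 <= s -> s * y <= b ->
  wmass K (s * y) - wmass K (s * x) <= s ^+ d * (wmass K y - wmass K x).
Proof.
move=> decf ax xy s1 syb; have [mf f0 nuE] := nuf.
have s0 : 0 < s := lt_le_trans ltr01 s1.
have x0 := le_trans a0 ax; have y0 := le_trans x0 xy.
have ysy : y <= s * y by rewrite ler_peMl.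
rewrite -lee_fin EFinM wmass_dilation//; try by rewrite (le_trans _ bl)// (le_trans ysy).
rewrite wmass_shellE//; last exact: le_trans syb.
rewrite lee_pmul2l// ?lte_fin ?exprn_gt0//.
apply: ge0_le_integral => //=.
- exact: measurable_shell.
- by move=> z _; rewrite lee_fin.
- by apply/measurable_EFinP/measurable_funTS/measurableT_comp => //; exact: measurable_dilation.
- exact/measurable_EFinP/measurable_funTS.
move=> z xyz; rewrite lee_fin; have [Az Asz] := shell_sub ax xy s1 syb xyz.
rewrite -lerN2.
exact: increasing_on_dilation (decreasing_onN decf) s1 (shell_neq_vertex x0 xyz) Az Asz.
Qed.

End monotone_density.

End wedge_mass.

(** * Convexity from dilations *)

Section convex_in_power.
Context {R : realType} (d : nat) (H : R -> R) (a b : R).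
Hypotheses (a0 : 0 <= a).
Hypothesis H_dilation : forall x y s, a <= x -> x <= y -> 1 <= s -> s * y <= b ->
  s ^+ d * (H y - H x) <= H (s * y) - H (s * x).

(** With q = r^d and m0 = H(p r) - H(p), the shell between p r^i and p r^(i+1) weighs at least q^i
    m0; the sum over i <= M is m0 (q^(M+1) - 1)/(q - 1). The denominator is cleared so that r = 1 is
    allowed. *)
Let up p r M : a <= p -> 1 <= r -> p * r ^+ M.+1 <= b ->
  (H (p * r) - H p) * ((r ^+ d) ^+ M.+1 - 1) <= (H (p * r ^+ M.+1) - H p) * (r ^+ d - 1).
Proof.
move=> ap r1; elim: M => [|M IHM] prb; first by rewrite !expr1 mulrC.
have r0 : 0 < r := lt_le_trans ltr01 r1; have p0 := le_trans a0 ap.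
have q0 : 0 <= r ^+ d - 1 by rewrite subr_ge0 exprn_ege1.
have := @H_dilation p (p * r) (r ^+ M.+1) ap.
rewrite ler_peMr// exprn_ege1// mulrCA -exprSr (mulrC (r ^+ M.+1) p).
move=> /(_ isT isT prb).
have /IHM : p * r ^+ M.+1 <= b.
  by apply: le_trans prb; rewrite ler_wpM2l// [leRHS]exprS ler_peMl// exprn_ge0// ltW.
rewrite -!exprM (mulnC M.+1 d) !(exprM r d).
set q := r ^+ d in q0 *; rewrite [q ^+ M.+2]exprSr; set Q := q ^+ M.+1.
set m0 := H (p * r) - H p => IH /(ler_wpM2r q0).
lra.
Qed.

(** The same reference mass m0 now bounds from above: the i-th shell below p weighs at most q^(-i)
    m0, and these factors sum to (1 - q^(-L))/(q - 1). *)
Let down p r L : a <= p / r ^+ L -> 1 <= r -> p * r <= b -> 0 < p ->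
  (H p - H (p / r ^+ L)) * (r ^+ d - 1) <= (H (p * r) - H p) * (1 - (r ^+ d) ^- L).
Proof.
move=> + r1 prb p0; have r0 : 0 < r := lt_le_trans ltr01 r1.
have q0 : 0 <= r ^+ d - 1 by rewrite subr_ge0 exprn_ege1.
elim: L => [|L IHL] apL; first by rewrite !expr0 invr1 mulr1 !subrr mul0r mulr0.
have pLL : p / r ^+ L.+1 <= p / r ^+ L.
  by rewrite ler_pM2l// lef_pV2 ?posrE ?exprn_gt0// exprS ler_peMl// exprn_ge0// ltW.
have := @H_dilation _ (p / r ^+ L) (r ^+ L.+1) apL pLL (exprn_ege1 _ r1).
rewrite (_ : r ^+ L.+1 * (p / r ^+ L.+1) = p); last first.
  by rewrite mulrC divfK// gt_eqF ?exprn_gt0.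
rewrite (_ : r ^+ L.+1 * (p / r ^+ L) = p * r); last first.
  by rewrite exprS; field; rewrite gt_eqF ?exprn_gt0.
move=> /(_ prb); have := IHL (le_trans apL pLL).
rewrite -!exprM (mulnC L.+1 d) !(exprM r d); set q := r ^+ d in q0 *.
have Q0 : 0 < q ^+ L.+1 by rewrite exprn_gt0// exprn_gt0.
set m0 := H (p * r) - H p => IH.
rewrite mulrC -ler_pdivlMr// => /(ler_wpM2r q0).
have qL : q ^- L = q ^- L.+1 * q.
  by rewrite exprS; field; rewrite !gt_eqF ?exprn_gt0// exprn_gt0.
move: IH; rewrite qL; set Q := q ^- L.+1; lra.
Qed.

(* The shells between consecutive points [p r^i] have masses that grow at least like
   their volumes, so the average density of the shells above [p] is at least the
   average density of those below [p]. *)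
Let geometric p r L M : 0 < p -> 1 <= r -> a <= p / r ^+ L -> p * r ^+ M <= b ->
  (H p - H (p / r ^+ L)) * ((p * r ^+ M) ^+ d - p ^+ d) <=
  (H (p * r ^+ M) - H p) * (p ^+ d - (p / r ^+ L) ^+ d).
Proof.
move=> p0 r1 apL; case: M => [|M] pMb.
  by rewrite expr0 mulr1 !subrr mul0r mulr0.
have r0 : 0 < r := lt_le_trans ltr01 r1.
have ap : a <= p by rewrite (le_trans apL)// ler_pdivrMr ?exprn_gt0// ler_peMr ?exprn_ege1// ltW.
have prb : p * r <= b.
  by apply: le_trans pMb; rewrite ler_pM2l// exprS ler_peMr ?exprn_ege1// ltW.
have := up ap r1 pMb; have := down apL r1 prb p0.
rewrite expr_div_n exprMn -!exprM !(mulnC _ d) !exprM.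
have v0 : 0 < p ^+ d by rewrite exprn_gt0.
set v := p ^+ d in v0 *; have : 1 <= r ^+ d by rewrite exprn_ege1.
(* If q = 1 both volume differences vanish. Otherwise multiplying by q - 1 > 0 lets [down] and [up]
   meet at m0 (1 - q^(-L)) v (q^(M+1) - 1). *)
set q := r ^+ d; rewrite le_eqVlt => /predU1P[<-|q1].
  by rewrite !expr1n !mulr1 !divr1 !subrr !mulr0.
have Q1 : 1 <= q ^+ M.+1 by rewrite exprn_ege1// ltW.
have QL : q ^- L <= 1 by rewrite invf_le1 ?exprn_ege1 ?exprn_gt0// ?ltW// (lt_trans ltr01).
set m0 := H (p * r) - H p; set A := H p - _; set B := H _ - H p => h1 h2.
rewrite -(ler_pM2r (_ : 0 < q - 1)) ?subr_gt0//.
have h1' := ler_wpM2r (_ : 0 <= v * (q ^+ M.+1 - 1)) h1.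
have h2' := ler_wpM2r (_ : 0 <= v * (1 - q ^- L)) h2.
apply: (@le_trans _ _ (m0 * (1 - q ^- L) * (v * (q ^+ M.+1 - 1)))).
  apply: le_trans (h1' _); last by rewrite mulr_ge0 ?subr_ge0// ltW.
  by rewrite le_eqVlt; apply/orP; left; apply/eqP; ring.
apply: le_trans (le_trans (h2' _) _); last 2 first.
- by rewrite mulr_ge0 ?subr_ge0// ltW.
- by rewrite le_eqVlt; apply/orP; left; apply/eqP; ring.
by rewrite le_eqVlt; apply/orP; left; apply/eqP; ring.
Qed.

(** The ends [a] and [b] need not be terms of a common geometric progression through [p], so they
    are only approximated: one term is placed in [a, a'] and one in [b', b]. *)
Let geometric_step p a' b' : a < a' -> a' < p -> p < b' -> b' < b ->
  exists xy : R * R, [/\ a <= xy.1 <= a', b' <= xy.2 <= b &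
    (H p - H xy.1) * (xy.2 ^+ d - p ^+ d) <= (H xy.2 - H p) * (p ^+ d - xy.1 ^+ d)].
Proof.
move=> aa' a'p pb' b'b; have a'0 := le_lt_trans a0 aa'; have p0 := lt_trans a'0 a'p.
have b'0 := lt_trans p0 pb'.
(* The bound b / b' makes the ratio so small that the progression cannot jump over [b', b]. The
   second bound yields a r <= a'; its shift by 1 avoids dividing by [a], which may be 0. *)
pose r := Num.min (b / b') ((a' + 1) / (a + 1)).
have a10 : 0 < a + 1 by rewrite ltr_wpDl.
have r1 : 1 < r by rewrite lt_min !ltr_pdivlMr// !mul1r b'b ltrD2r.
have r0 : 0 < r := lt_trans ltr01 r1.
have rb : b' * r <= b by rewrite mulrC -ler_pdivlMr// ge_min lexx.
have ra : a * r <= a'.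
  have : r * (a + 1) <= a' + 1 by rewrite -ler_pdivlMr// ge_min lexx orbT.
  by move: (ltW r1); lra.
have unb x : exists n, x < r ^+ n.
  exists (Num.truncn `|x / (r - 1)|).+1.
  have r10 : 0 < r - 1 by rewrite subr_gt0.
  have bern n : n%:R * (r - 1) <= r ^+ n.
    elim: n => [|n IHn]; first by rewrite mul0r.
    have : 1 <= r ^+ n by rewrite exprn_ege1// ltW.
    rewrite exprS -natr1 => rn.
    have : (r - 1) * 1 <= (r - 1) * r ^+ n by rewrite ler_pM2l.
    by lra.
  apply: lt_le_trans (bern _); rewrite -ltr_pdivrMr//.
  exact: le_lt_trans (ler_norm _) (truncnS_gt _).
(* [M] is the last index with p r^M <= b, and [L] below the first one with p / r^L <= a'; minimality
   gives the inequality on the other side. *)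
have [M pM pM1] : exists2 M, p * r ^+ M <= b & b < p * r ^+ M.+1.
  have [n hn] := unb (b / p); have exn : exists n, b < p * r ^+ n.
    by exists n; rewrite mulrC -ltr_pdivrMr.
  case: (ex_minnP exn) => -[|m] bm minm.
    by move: bm; rewrite expr0 mulr1 ltNge (le_trans (ltW pb') (ltW b'b)).
  by exists m => //; rewrite leNgt; apply/negP => /minm; rewrite ltnn.
have [L pL pL1] : exists2 L, p / r ^+ L <= a' & a' / r < p / r ^+ L.
  have [n hn] := unb (p / a'); have exn : exists n, p / r ^+ n <= a'.
    by exists n; rewrite ler_pdivrMr ?exprn_gt0// mulrC -ler_pdivrMr// ltW.
  case: (ex_minnP exn) => -[|m] am minm.
    by move: am; rewrite expr0 divr1 leNgt a'p.
  exists m.+1 => //; rewrite exprSr invfM mulrA ltr_pM2r ?invr_gt0//.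
  by rewrite ltNge; apply/negP => /minm; rewrite ltnn.
exists (p / r ^+ L, p * r ^+ M); have ap : a <= p / r ^+ L.
  by rewrite (le_trans _ (ltW pL1))// ler_pdivlMr.
split => /=; [by rewrite ap| |exact: (geometric p0 (ltW r1))].
rewrite pM andbT -(ler_pM2r r0) (le_trans rb)// (le_trans (ltW pM1))//.
by rewrite exprSr mulrA.
Qed.

(** The chord inequality for [H] as a function of z^d, denominators cleared. [geometric_step] is
    applied with targets shrinking to the two ends, and continuity of [H] passes the inequality to
    the limit. *)
Lemma dilation_convex p : continuous H -> a <= p -> p <= b ->
  (H p - H a) * (b ^+ d - p ^+ d) <= (H b - H p) * (p ^+ d - a ^+ d).
Proof.
move=> cH; rewrite le_eqVlt => /predU1P[->|ap]; first by rewrite !subrr mul0r mulr0.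
rewrite le_eqVlt => /predU1P[->|pb]; first by rewrite !subrr mul0r mulr0.
(* The factor 1/2 keeps a_ n < p < b_ n already at n = 0, where [harmonic n] is 1. *)
pose a_ n := a + (p - a) / 2 * harmonic n; pose b_ n := b - (b - p) / 2 * harmonic n.
have ha n : 0 < harmonic n :> R by rewrite /harmonic/= invr_gt0.
have h1 n : harmonic n <= 1 :> R by rewrite /harmonic/= invf_le1 ?ler1n.
have xyP n : exists xy : R * R, [/\ a <= xy.1 <= a_ n, b_ n <= xy.2 <= b &
    (H p - H xy.1) * (xy.2 ^+ d - p ^+ d) <= (H xy.2 - H p) * (p ^+ d - xy.1 ^+ d)].
  have pa : 0 < (p - a) / 2 by rewrite divr_gt0// subr_gt0.
  have bp : 0 < (b - p) / 2 by rewrite divr_gt0// subr_gt0.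
  apply: geometric_step; rewrite /a_ /b_.
  - by rewrite ltrDl mulr_gt0.
  - have : (p - a) / 2 * harmonic n <= (p - a) / 2 by rewrite ler_piMr// ltW.
    lra.
  - have : (b - p) / 2 * harmonic n <= (b - p) / 2 by rewrite ler_piMr// ltW.
    lra.
  - by rewrite gtrBl mulr_gt0.
have /choice[xy {}xyP] := xyP.
have a_a : a_ n @[n --> \oo] --> a.
  rewrite -[X in _ --> X]addr0 -[X in _ --> _ + X](mulr0 ((p - a) / 2)).
  by apply: cvgD; [exact: cvg_cst|apply: cvgM; [exact: cvg_cst|exact: cvg_harmonic]].
have b_b : b_ n @[n --> \oo] --> b.
  rewrite -[X in _ --> X]subr0 -[X in _ --> _ - X](mulr0 ((b - p) / 2)).
  by apply: cvgB; [exact: cvg_cst|apply: cvgM; [exact: cvg_cst|exact: cvg_harmonic]].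
have xa : (xy n).1 @[n --> \oo] --> a.
  apply: squeeze_cvgr (cvg_cst a) a_a.
  by apply: nearW => n; case: (xyP n).
have yb : (xy n).2 @[n --> \oo] --> b.
  apply: squeeze_cvgr b_b (cvg_cst b).
  by apply: nearW => n; case: (xyP n).
have cX (x : R) (u : R^nat) : u n @[n --> \oo] --> x -> u n ^+ d @[n --> \oo] --> x ^+ d.
  by move=> ux; apply: (@continuous_cvg _ _ _ _ _ u (fun z : R => z ^+ d)) => //;
    exact: exprn_continuous.
have cHu (x : R) (u : R^nat) : u n @[n --> \oo] --> x -> H (u n) @[n --> \oo] --> H x.
  by move=> ux; apply: (@continuous_cvg _ _ _ _ _ u H) => //; exact: cH.
have c1 : H p - H (xy n).1 @[n --> \oo] --> H p - H a.
  by apply: cvgB; [exact: cvg_cst|exact: cHu].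
have c2 : (xy n).2 ^+ d - p ^+ d @[n --> \oo] --> b ^+ d - p ^+ d.
  by apply: cvgB; [exact: cX|exact: cvg_cst].
have c3 : H (xy n).2 - H p @[n --> \oo] --> H b - H p.
  by apply: cvgB; [exact: cHu|exact: cvg_cst].
have c4 : p ^+ d - (xy n).1 ^+ d @[n --> \oo] --> p ^+ d - a ^+ d.
  by apply: cvgB; [exact: cvg_cst|exact: cX].
apply: ler_cvg_to (cvgM c1 c2) (cvgM c3 c4) _.
by apply: nearW => n; case: (xyP n).
Qed.

End convex_in_power.

(** * Absence of atoms and ties *)

Lemma negligible_exists d (T : measurableType d) (R : realType)
    (mu : {measure set T -> \bar R}) (I : countType) (A : I -> set T) :
  (forall i, mu.-negligible (A i)) -> mu.-negligible [set x | exists i, A i x].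
Proof.
move=> A0; pose B n := if unpickle n is Some i then A i else set0.
apply: (@negligibleS _ _ _ _ (\bigcup_n B n)).
  by move=> x [i Ax]; exists (pickle i) => //; rewrite /B pickleK.
apply: negligible_bigcup => n; rewrite /B; case: (unpickle n) => [i|]; first exact: A0.
by exists set0; split.
Qed.

Section no_atoms.
Context {R : realType} {d : nat} (nu : probability 'rV[R]_d R) (f : 'rV[R]_d -> R).
Hypothesis nuf : density nu f.
Context (K : wedge_shape R d).
Hypothesis K0 : wdir K != 0.
Local Notation H := (wmass nu K).

(** Shells of half-width [harmonic n] around [z] decrease to a subset of a hyperplane, which is
    null; since [H] is monotone, a small shell mass bounds its variation near [z]. *)
Lemma wmass_continuous : continuous H.
Proof.
move=> z; pose F n := shell K (z - harmonic n) (z + harmonic n).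
have h0 n : 0 < harmonic n :> R by rewrite /harmonic/= invr_gt0.
have FE n : nu (F n) = (H (z + harmonic n) - H (z - harmonic n))%:E.
  by rewrite wmass_shell//; have := h0 n; lra.
have cF : nu \o F @ \oo --> 0%E.
  rewrite -(_ : nu (\bigcap_n F n) = 0%E).
    apply: nonincreasing_cvg_mu.
    - by have := FE 0%N; rewrite /= => ->; rewrite ltry.
    - by move=> n; exact: measurable_shell.
    - by apply: bigcapT_measurable => n; exact: measurable_shell.
    move=> m n mn; apply/subsetPset => x [Kx /andP[h1 h2]]; split => //.
    have hmn : harmonic n <= harmonic m :> R by rewrite /harmonic/= lef_pV2 ?posrE// ler_nat.
    by apply/andP; split; move: h1 h2 hmn; lra.
  apply/eqP; rewrite -measure_le0 -(density_hyperplane nuf z K0); apply: le_measure; rewrite ?inE.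
  - by apply: bigcapT_measurable => n; exact: measurable_shell.
  - rewrite -[X in measurable X]setTI.
    exact: measurable_wproj measurableT _ (measurable_set1 z).
  move=> x /= Fx; apply/eqP; rewrite -subr_eq0 -normr_le0.
  apply: ler_cvg_to (cvg_cst _) (@cvg_harmonic R) _; apply: nearW => n.
  have [_ /andP[h1 h2]] := Fx n I; rewrite ler_norml; apply/andP; split; move: h1 h2; lra.
apply/cvgrPdist_lt => e e0.
have /fine_cvg/cvgr0Pnorm_lt/(_ e e0)[n _ /(_ n (leqnn n))] := cF.
rewrite [(_ \o _) n]/= FE [fine _]/= => /(le_lt_trans (ler_norm _)) He.
exists (harmonic n) => [|y hy]; first exact: h0.
have {hy} : `|z - y| < harmonic n := hy.
rewrite ltr_norml => /andP[zy yz].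
have h1 : H (z - harmonic n) <= H y by apply: wmass_homo; move: zy yz; lra.
have h2 : H y <= H (z + harmonic n) by apply: wmass_homo; move: zy yz; lra.
have h3 : H (z - harmonic n) <= H z by apply: wmass_homo; have := h0 n; lra.
have h4 : H z <= H (z + harmonic n) by apply: wmass_homo; have := h0 n; lra.
by rewrite ltr_norml; apply/andP; split; lra.
Qed.

Lemma measurable_wmass : measurable_fun [set: R] H.
Proof. by apply: continuous_measurable_fun; exact: wmass_continuous. Qed.

Lemma measurable_wmass_wproj : measurable_fun [set: 'rV[R]_d] (fun x => H (wproj K x)).
Proof. exact: measurableT_comp measurable_wmass (@measurable_wproj _ _ K). Qed.

(** [H] may equal [c] on a whole interval. A projection strictly between two points of the level set
    lies in a null shell with rational ends, and such shells are countably many; there remain the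
    least and the greatest point of the level set, each giving a null hyperplane. *)
Lemma wmass_level_null c : nu (wset K `&` [set x | H (wproj K x) = c]) = 0%E.
Proof.
pose S := [set p | 0 < p /\ H p = c].
pose N (q : rat * rat) := if nu (shell K (ratr q.1) (ratr q.2)) == 0%E
  then shell K (ratr q.1) (ratr q.2) else set0.
have mlev : measurable (wset K `&` [set x | H (wproj K x) = c]).
  apply: measurableI; first exact: measurable_wset.
  rewrite -[X in measurable X]setTI.
  exact: measurable_wmass_wproj measurableT _ (measurable_set1 c).
apply/negligibleP => //.
have hyp0 (Q : set R) : (forall p q, Q p -> Q q -> p = q) -> nu.-negligible [set x | Q (wproj K x)].
  move=> Q1; have [[p Qp]|/forallNP Q0] := pselect (exists p, Q p); last first.
    by rewrite (_ : mkset _ = set0); [by exists set0; split|apply/seteqP; split => x //= /Q0].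
  exists [set x | wproj K x = p]; split.
  - rewrite -[X in measurable X]setTI.
    exact: measurable_wproj measurableT _ (measurable_set1 p).
  - exact: (density_hyperplane nuf p K0).
  - by move=> x /= Qx; exact: Q1.
have Nneg : nu.-negligible [set x | exists q, N q x].
  apply: negligible_exists => q; rewrite /N; case: ifP => [/eqP q0|_].
    by apply/negligibleP => //; exact: measurable_shell.
  by exists set0; split.
apply: (@negligibleS _ _ _ _ ([set x | exists q, N q x] `|`
   ([set x | S (wproj K x) /\ forall p, S p -> wproj K x <= p] `|`
    [set x | S (wproj K x) /\ forall p, S p -> p <= wproj K x]))).
  move=> x [Kx /= Hx]; have x0 : 0 < wproj K x by case: Kx => /andP[].
  have Sx : S (wproj K x) by split.
  have [|/existsNP[p /not_implyP[Sp /negP]]] :=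
    pselect (forall p, S p -> wproj K x <= p); first by move=> h; right; left.
  have [|/existsNP[p' /not_implyP[Sp' /negP]]] :=
    pselect (forall p, S p -> p <= wproj K x); first by move=> h; right; right.
  rewrite -!ltNge => xp' px; left.
  have [q1] := rat_in_itvoo px; have [q2] := rat_in_itvoo xp'.
  rewrite !in_itv/= => /andP[xq2 q2p] /andP[pq1 q1x].
  exists (q1, q2); rewrite /N/= ifT; first by split => //; rewrite q1x ltW.
  rewrite wmass_shell; last exact/ltW/(lt_trans q1x).
  have h1 := wmass_homo nu K (ltW pq1); have h2 := wmass_homo nu K (ltW q2p).
  have h3 := wmass_homo nu K (ltW (lt_trans q1x xq2)).
  case: Sp h1 => _ ->; case: Sp' h2 => _ -> h2 h1.
  by apply/eqP; congr EFin; apply/eqP; rewrite subr_eq0 eq_le h3 andbT (le_trans h2).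
apply: negligibleU => //; apply: negligibleU.
- apply: (hyp0 [set z | S z /\ forall p, S p -> z <= p]) => p q [Sp pm] [Sq qm].
  by apply/eqP; rewrite eq_le pm// qm.
- apply: (hyp0 [set z | S z /\ forall p, S p -> p <= z]) => p q [Sp pm] [Sq qm].
  by apply/eqP; rewrite eq_le pm// qm.
Qed.

End no_atoms.

Section ties.
Context {R : realType} {d n : nat} {disp : measure_display} {T : measurableType disp}
  {P : probability T R} (f : 'rV[R]_d -> R) (X : 'I_n -> {RV P >-> 'rV[R]_d}).
Hypotheses (Xf : forall i, has_density (X i) f) (indX : mutually_independent X).

Lemma distribution_density i : density (distribution P (X i)) f.
Proof. exact: Xf. Qed.

Lemma distribution_eq i j A : measurable A -> distribution P (X i) A = distribution P (X j) A.
Proof. by move=> mA; have [_ _ ->] := Xf i => //; have [_ _ ->] := Xf j. Qed.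

(** Mutual independence on {i, j} gives the joint law on rectangles only; uniqueness of the product
    measure extends it to [E]. *)
Lemma independent_pair i j (E : set ('rV[R]_d * 'rV[R]_d)) : i != j -> measurable E ->
  P [set w | E (X i w, X j w)] = (distribution P (X i) \x distribution P (X j))%E E.
Proof.
move=> ij mE; pose XY w := (X i w, X j w).
have mXY : measurable_fun [set: T] XY.
  by apply/measurable_fun_pairP; split; exact: measurable_funPT.
rewrite -[LHS]/(image_measure P mXY E); apply/esym/product_measure_unique => // A B mA mB.
pose C k := if k == i then A else B.
have mC k : measurable (C k) by rewrite /C; case: ifP.
have := indX [set i; j]%SET mC; rewrite big_setU1 ?inE//= big_set1 /C eqxx.
rewrite (eq_sym j) (negbTE ij) => <-; congr (P _); apply/seteqP; split => w /=.
  by move=> [Aw Bw] k /=; rewrite !inE => /orP[] /eqP ->; rewrite ?eqxx// eq_sym (negbTE ij).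
move=> ABw; split; first by have := ABw i; rewrite /= !inE eqxx; apply.
by have := ABw j; rewrite /= !inE eqxx orbT eq_sym (negbTE ij); apply.
Qed.

Section wedge.
Context (K : wedge_shape R d) (i0 : 'I_n).
Hypothesis K0 : wdir K != 0.
Local Notation H := (wmass (distribution P (X i0)) K).

(** By Fubini, fixing one point leaves a level set of [H] for the other. The index [i0] names the
    law common to all observations, so that a single [H] serves for every pair. *)
Lemma no_tie i j : i != j ->
  P [set w | [/\ wset K (X i w), wset K (X j w) & H (wproj K (X i w)) = H (wproj K (X j w))]] = 0%E.
Proof.
move=> ij; have mH := measurable_wmass_wproj (distribution_density i0) K0.
pose E : set ('rV[R]_d * 'rV[R]_d) := [set xy |
  [/\ wset K xy.1, wset K xy.2 & H (wproj K xy.1) = H (wproj K xy.2)]].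
have mE : measurable E.
  rewrite (_ : E = (wset K `*` wset K) `&` [set xy | H (wproj K xy.1) == H (wproj K xy.2)]).
    apply: measurableI; first by apply: measurableX; exact: measurable_wset.
    apply: measurable_set_bool; apply: measurable_fun_eqr.
      exact: measurableT_comp mH measurable_fst.
    exact: measurableT_comp mH measurable_snd.
  apply/seteqP; split => xy /=; last by move=> [[? ?] /eqP ?].
  by move=> [? ? /eqP ?].
rewrite (independent_pair ij mE) /product_measure1/= integral0_eq// => x _ /=.
transitivity (distribution P (X i0) (xsection E x)).
  exact/distribution_eq/measurable_xsection.
apply/eqP; rewrite -measure_le0.
rewrite -(wmass_level_null (distribution_density i0) K0 (H (wproj K x))).
apply: le_measure; rewrite ?inE.
- exact: measurable_xsection.
- apply: measurableI; first exact: measurable_wset.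
  rewrite -[X in measurable X]setTI.
  exact: mH measurableT _ (measurable_set1 _).
by move=> y; rewrite /xsection/= inE => -[].
Qed.

Lemma no_zero i :
  P [set w | wset K (X i w) /\ H (wproj K (X i w)) = 0] = 0%E.
Proof.
rewrite -[LHS]/(distribution P (X i) (wset K `&` [set x | H (wproj K x) = 0])).
have mH := measurable_wmass_wproj (distribution_density i0) K0.
rewrite (distribution_eq i i0); first exact: (wmass_level_null (distribution_density i0) K0 0).
apply: measurableI; first exact: measurable_wset.
rewrite -[X in measurable X]setTI.
exact: mH measurableT _ (measurable_set1 _).
Qed.

End wedge.
End ties.

(** * Order statistics *)

Section order_statistics.
Context {R : realType} {d n : nat} (K : wedge_shape R d) (y : 'I_n -> 'rV[R]_d).

(** Indices are sorted instead of points: the list stays duplicate-free even when observations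
    coincide, and it takes finitely many values, which the measurability proofs exploit. *)
Definition obs_index : seq 'I_n :=
  sort (fun i j => wproj K (y i) <= wproj K (y j)) [seq i <- enum 'I_n | y i \in wset K].

Lemma observationsE : observations K y = map y obs_index.
Proof. by rewrite /observations sort_map. Qed.

Lemma obs_countE : obs_count K y = size obs_index.
Proof. by rewrite /obs_count observationsE size_map. Qed.

Lemma order_stat0 : order_stat K y 0 = wvertex K.
Proof. by []. Qed.

Lemma order_statS i0 j : (j < obs_count K y)%N ->
  order_stat K y j.+1 = y (nth i0 obs_index j).
Proof. by rewrite obs_countE => jN; rewrite /order_stat/= observationsE (nth_map i0). Qed.

Lemma proj_stat0 : proj_stat K y 0 = 0.
Proof.
by rewrite /proj_stat order_stat0 /wproj subrr /dot big1// => i _; rewrite mxE mul0r.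
Qed.

Lemma uniq_obs_index : uniq obs_index.
Proof. by rewrite sort_uniq filter_uniq// enum_uniq. Qed.

Lemma obs_index_wset i : i \in obs_index -> wset K (y i).
Proof. by rewrite mem_sort mem_filter => /andP[/set_mem]. Qed.

Lemma order_stat_index j : (0 < j <= obs_count K y)%N ->
  exists2 i, i \in obs_index & order_stat K y j = y i /\ index i obs_index = j.-1.
Proof.
case: j => [|j]//=; rewrite obs_countE => jN.
case s_ : obs_index => [|i0 s]; first by move: jN; rewrite s_.
rewrite -s_; exists (nth i0 obs_index j); first exact: mem_nth.
by rewrite index_uniq ?uniq_obs_index// (order_statS i0)// obs_countE.
Qed.

Lemma order_stat_wset j : (0 < j <= obs_count K y)%N -> wset K (order_stat K y j).
Proof. by move=> /order_stat_index[i /obs_index_wset Ki [-> _]]. Qed.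

Lemma proj_stat_ge0 j : (j <= obs_count K y)%N -> 0 <= proj_stat K y j.
Proof.
case: j => [|j] jN; first by rewrite proj_stat0.
by have [/andP[/ltW]] := @order_stat_wset j.+1 jN.
Qed.

Lemma proj_stat_length j : (0 < j <= obs_count K y)%N -> proj_stat K y j <= Defs.wlength K.
Proof. by move=> /order_stat_wset[/andP[]]. Qed.

Lemma proj_stat_homo j k : (j <= k <= obs_count K y)%N -> proj_stat K y j <= proj_stat K y k.
Proof.
move=> /andP[]; case: j => [|j] jk kN; first by rewrite proj_stat0 proj_stat_ge0.
case: k => [//|k] in jk kN *.
case s_ : obs_index => [|i0 s]; first by move: kN; rewrite obs_countE s_.
rewrite /proj_stat !(order_statS i0)//; last exact: leq_trans kN.
pose r i i' := wproj K (y i) <= wproj K (y i').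
have r_sorted : sorted r obs_index by apply: sort_sorted => i i'; exact: le_total.
apply: (@sorted_leq_nth _ r _ _ i0 _ r_sorted); rewrite ?inE -?obs_countE//.
- by move=> ? ? ?; exact: le_trans.
- by move=> i; exact: lexx.
- exact: leq_trans kN.
Qed.

Section no_ties.
Context (H : R -> R).
Hypotheses (H0 : H 0 = 0) (H_homo : {homo H : a b / a <= b}).
Hypothesis H_neq0 : forall i, wset K (y i) -> H (wproj K (y i)) <> 0.
Hypothesis H_neq : forall i j, i != j -> wset K (y i) -> wset K (y j) ->
  H (wproj K (y i)) <> H (wproj K (y j)).

(** Different ranks belong to different indices, so [H_neq] rules out equality. Rank 0 is the vertex
    and has no index; there [H0] and [H_neq0] take over. *)
Lemma proj_stat_mass_lt j k : (j < k <= obs_count K y)%N ->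
  H (proj_stat K y j) < H (proj_stat K y k).
Proof.
move=> /andP[jk kN]; have k0 : (0 < k)%N by case: k jk {kN}.
have [|i iK [kE ik]] := @order_stat_index k; first by rewrite k0.
rewrite lt_neqAle H_homo ?andbT; last by apply: proj_stat_homo; rewrite ltnW.
case: j jk => [|j] jk.
  by rewrite proj_stat0 H0 /proj_stat kE; apply/eqP => /esym/H_neq0; apply; exact: obs_index_wset.
have [|i' iK' [jE ij]] := @order_stat_index j.+1; first by rewrite (leq_trans (ltnW jk)).
rewrite /proj_stat kE jE; apply/eqP; apply: H_neq; try exact: obs_index_wset.
by apply: contraTneq jk => ii'; rewrite -(prednK k0) -ik -ii' ij /= ltnn.
Qed.

Lemma proj_stat_lt j k : (j < k <= obs_count K y)%N -> proj_stat K y j < proj_stat K y k.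
Proof.
move=> /proj_stat_mass_lt Hjk; rewrite ltNge; apply/negP => /H_homo.
by rewrite leNgt Hjk.
Qed.

End no_ties.

(** A rank of at most N puts the part of the wedge with P x <= P X_(j) inside K_N, so the
    intersection with [observed_part] drops out and both integrals become masses. *)
Lemma F_tildeE (nu : probability 'rV[R]_d R) f (nuf : density nu f) j :
  (j <= obs_count K y)%N -> F_tilde f K y (proj_stat K y j) =
  wmass nu K (proj_stat K y j) / wmass nu K (proj_stat K y (obs_count K y)).
Proof.
move=> jN; have [_ _ nuE] := nuf.
have obsE : observed_part K y = wset K `&` [set x | wproj K x <= proj_stat K y (obs_count K y)].
  apply/seteqP; split => x /=; first by move=> [? /andP[_ ?]].
  by move=> [Kx ?]; split => //; apply/andP; split => //; case: Kx => /andP[].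
have -> : F_tilde f K y (proj_stat K y j) =
    fine (nu (wset K `&` [set x | wproj K x <= proj_stat K y j])) /
    fine (nu (wset K `&` [set x | wproj K x <= proj_stat K y (obs_count K y)])).
  rewrite !nuE; [|exact: measurable_wset_le|exact: measurable_wset_le].
  rewrite /F_tilde obsE -setIA (_ : _ `&` [set x | wproj K x <= proj_stat K y j] =
    [set x | wproj K x <= proj_stat K y j])//.
  apply/seteqP; split => x /=; first by case.
  by move=> xj; split => //; rewrite (le_trans xj)// proj_stat_homo// jN leqnn.
by [].
Qed.

End order_statistics.

(** * Comparison of T with T^U under monotonicity *)

Section comparison.
Context {R : realType} {d n : nat} (K : wedge_shape R d) (y : 'I_n -> 'rV[R]_d).
Context (nu : probability 'rV[R]_d R) (f : 'rV[R]_d -> R) (nuf : density nu f).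
Hypotheses (d0 : (0 < d)%N) (K0 : wdir K != 0).
Local Notation H := (wmass nu K).
Local Notation p := (proj_stat K y).
Hypothesis H_neq0 : forall i, wset K (y i) -> H (wproj K (y i)) <> 0.
Hypothesis H_neq : forall i j, i != j -> wset K (y i) -> wset K (y j) ->
  H (wproj K (y i)) <> H (wproj K (y j)).

Lemma TU_statE j k : (k <= obs_count K y)%N -> TU_stat f K y j k =
  let F j := H (p j) / H (p (obs_count K y)) in
  \sum_(j.+1 <= l < k) beta_kernel ((F l - F j) / (F k - F j)).
Proof.
move=> kN; rewrite /TU_stat/= !big_nat; apply: eq_bigr => l /andP[jl lk].
have lN := leq_trans (ltnW lk) kN.
by rewrite !(F_tildeE nuf)// (leq_trans (ltnW jl)).
Qed.

Let Hlt j k : (j < k <= obs_count K y)%N -> H (p j) < H (p k).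
Proof.
exact: (proj_stat_mass_lt (wmass_le0 nu K (lexx 0)) (@wmass_homo _ _ nu K)
  H_neq0 H_neq).
Qed.

Let plt j k : (j < k <= obs_count K y)%N -> p j < p k.
Proof.
exact: (proj_stat_lt (wmass_le0 nu K (lexx 0)) (@wmass_homo _ _ nu K)
  H_neq0 H_neq).
Qed.

(** Both arguments have to be interior: [beta_kernel 0] is 0 and exceeds [beta_kernel u] for 0 < u <
    1/2. *)
Lemma beta_kernel_homo (u v : R) : 0 < u < 1 -> 0 < v < 1 -> u <= v ->
  beta_kernel u <= beta_kernel v.
Proof. by move=> u01 v01 uv; rewrite /beta_kernel u01 v01 lerD2r ler_pM2l. Qed.

Let ratio01 (a b c : R) : a < b -> b < c -> 0 < (b - a) / (c - a) < 1.
Proof.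
move=> ab bc; have ac := lt_trans ab bc.
by rewrite divr_gt0 ?subr_gt0//= ltr_pdivrMr ?subr_gt0// mul1r ltrD2r.
Qed.

Let normalized (a b c e : R) : 0 < e -> a < c ->
  (b / e - a / e) / (c / e - a / e) = (b - a) / (c - a).
Proof.
by move=> e0 ac; field; rewrite !gt_eqF ?subr_gt0 ?ltr_pM2r ?invr_gt0.
Qed.

Let obs_mass_gt0 j k : (j < k <= obs_count K y)%N -> 0 < H (p (obs_count K y)).
Proof.
move=> /andP[jk kN]; rewrite -(wmass_le0 nu K (lexx 0)) -(proj_stat0 K y).
by apply: Hlt; rewrite leqnn andbT (leq_trans _ kN)// (leq_ltn_trans _ jk).
Qed.

Let ptX j k : (j < k <= obs_count K y)%N -> p j ^+ d < p k ^+ d.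
Proof.
move=> jk; rewrite ltr_pXn2r// ?nnegrE; first exact: plt.
- by apply: proj_stat_ge0; case/andP: jk => /ltnW/leq_trans; apply.
- by apply: proj_stat_ge0; case/andP: jk.
Qed.

Lemma T_stat_increasing j k : (j < k <= obs_count K y)%N ->
  increasing_on f (wvertex K) (subsection K y j k) ->
  TU_stat f K y j k <= T_stat K y j k.
Proof.
move=> jkN incf; have /andP[jk kN] := jkN; rewrite TU_statE// /T_stat /=.
rewrite !big_nat; apply: ler_sum => l /andP[jl lk].
have jlN : (j < l <= obs_count K y)%N by rewrite jl (leq_trans (ltnW lk)).
have lkN : (l < k <= obs_count K y)%N by rewrite lk kN.
rewrite normalized ?(obs_mass_gt0 jkN) ?Hlt//.
apply: beta_kernel_homo; [exact: ratio01 (Hlt _) (Hlt _)|exact: ratio01 (ptX _) (ptX _)|].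
rewrite ler_pdivrMr ?subr_gt0 ?Hlt// mulrAC ler_pdivlMr ?subr_gt0 ?ptX//.
have := @dilation_convex R d H (p j) (p k) _ _ (p l)
   (wmass_continuous nuf K0) (ltW (plt jlN)) (ltW (plt lkN)).
have pj0 : 0 <= p j by apply: proj_stat_ge0; rewrite (leq_trans (ltnW jk)).
have pkl : p k <= Defs.wlength K by apply: proj_stat_length; rewrite kN (leq_ltn_trans _ jk).
have dil a b s := @wmass_increasing _ _ _ _ nuf _ _ _ pj0 pkl a b s incf.
move=> /(_ pj0 dil).
(* Adding (H(p l) - H(p j)) (p l^d - p j^d) to both sides of the convexity inequality gives the
   cross-multiplied comparison of the two ratios. *)
lra.
Qed.

Lemma T_stat_decreasing j k : (j < k <= obs_count K y)%N ->
  decreasing_on f (wvertex K) (subsection K y j k) ->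
  T_stat K y j k <= TU_stat f K y j k.
Proof.
move=> jkN incf; have /andP[jk kN] := jkN; rewrite TU_statE// /T_stat /=.
rewrite !big_nat; apply: ler_sum => l /andP[jl lk].
have jlN : (j < l <= obs_count K y)%N by rewrite jl (leq_trans (ltnW lk)).
have lkN : (l < k <= obs_count K y)%N by rewrite lk kN.
rewrite normalized ?(obs_mass_gt0 jkN) ?Hlt//.
apply: beta_kernel_homo; [exact: ratio01 (ptX _) (ptX _)|exact: ratio01 (Hlt _) (Hlt _)|].
rewrite ler_pdivrMr ?subr_gt0 ?ptX// mulrAC ler_pdivlMr ?subr_gt0 ?Hlt//.
(* A decreasing density reverses the dilation inequality, so the convexity lemma is fed with - H. *)
have cH : continuous (fun z => - H z).
  by move=> z; apply: continuousN; exact: (wmass_continuous nuf K0).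
have := @dilation_convex R d (fun z => - H z) (p j) (p k) _ _ (p l)
   cH (ltW (plt jlN)) (ltW (plt lkN)).
have pj0 : 0 <= p j by apply: proj_stat_ge0; rewrite (leq_trans (ltnW jk)).
have pkl : p k <= Defs.wlength K by apply: proj_stat_length; rewrite kN (leq_ltn_trans _ jk).
have dil a b s : p j <= a -> a <= b -> 1 <= s -> s * b <= p k ->
    s ^+ d * (- H b - - H a) <= - H (s * b) - - H (s * a).
  move=> pja ab s1 sb; have := wmass_decreasing nuf pj0 pkl incf pja ab s1 sb.
  lra.
move=> /(_ pj0 dil).
lra.
Qed.

End comparison.

(** * Measurability of the statistics *)

Section measurable_beta.
Context {R : realType}.

Lemma measurable_inv : measurable_fun [set: R] (fun x : R => x^-1).
Proof.
(* Squaring moves the base to the nonnegative reals, where the real power with exponent -1 is the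
   inverse; at 0 both sides are 0. *)
rewrite (_ : (fun x : R => x^-1) = (fun x => x * (x ^+ 2) `^ (-1))).
  apply: measurable_funM => //.
  by apply: (measurableT_comp (measurable_powR _)); exact: measurable_funX.
apply/funext => x; rewrite powR_inv1 ?sqr_ge0//.
have [->|x0] := eqVneq x 0; first by rewrite invr0 mul0r.
by field.
Qed.

Lemma measurable_beta_kernel : measurable_fun [set: R] (@beta_kernel R).
Proof.
apply: measurable_fun_ifT => //.
  by apply: measurable_and; apply: measurable_fun_ltr.
by apply: measurable_funB => //; exact: measurable_funM.
Qed.

Lemma measurable_beta_ratio d (T : measurableType d) (u v : T -> R) :
  measurable_fun [set: T] u -> measurable_fun [set: T] v ->
  measurable_fun [set: T] (fun x => beta_kernel (u x / v x)).
Proof.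
move=> mu mv; apply: (measurableT_comp measurable_beta_kernel).
by apply: measurable_funM => //; exact: (measurableT_comp measurable_inv).
Qed.

End measurable_beta.

Section measurable_order_statistics.
Context {R : realType} {d n : nat} {disp : measure_display} {T : measurableType disp}.
Context (K : wedge_shape R d) (Y : T -> 'I_n -> 'rV[R]_d).
Hypothesis mY : forall i, measurable_fun [set: T] (Y ^~ i).

Definition order_data (y : 'I_n -> 'rV[R]_d) : {ffun 'I_n -> bool} * {ffun 'I_n * 'I_n -> bool} :=
  ([ffun i => y i \in wset K], [ffun ij => wproj K (y ij.1) <= wproj K (y ij.2)]).

Lemma obs_index_data y : obs_index K y =
  sort (fun i j => (order_data y).2 (i, j)) [seq i <- enum 'I_n | (order_data y).1 i].
Proof.
rewrite /obs_index; congr sort; last by apply: eq_filter => i; rewrite ffunE.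
by apply/funext => i; apply/funext => j; rewrite ffunE.
Qed.

Let mproj i : measurable_fun [set: T] (fun w => wproj K (Y w i)).
Proof. exact: measurableT_comp (@measurable_wproj _ _ K) (mY i). Qed.

Let mdata b : measurable [set w | order_data (Y w) = b].
Proof.
rewrite (_ : mkset _ = [set w | forall i, (Y w i \in wset K) = b.1 i] `&`
  [set w | forall ij, (wproj K (Y w ij.1) <= wproj K (Y w ij.2)) = b.2 ij]).
  apply: measurableI; apply: measurable_forall => i.
    suff : measurable_fun [set: T] (fun w => Y w i \in wset K).
      by move=> /(_ measurableT [set b.1 i]); rewrite setTI; apply.
    apply: (measurable_fun_bool true).
    rewrite (_ : _ @^-1` _ = (Y ^~ i) @^-1` wset K).
      by apply: mY => //; exact: measurable_wset.
    by apply/seteqP; split => w /=; [move=> /set_mem|move=> /mem_set].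
  suff : measurable_fun [set: T] (fun w => wproj K (Y w i.1) <= wproj K (Y w i.2)).
    by move=> /(_ measurableT [set b.2 i]); rewrite setTI; apply.
  exact: measurable_fun_ler.
apply/seteqP; split => w /=.
  by move=> <-; split => i; rewrite ffunE.
case: b => b1 b2 /= [h1 h2]; congr pair; apply/ffunP => i; rewrite ffunE//.
Qed.

(* [obs_index] is a function of finitely many measurable bits. *)
Lemma measurable_obs_index (Q : seq 'I_n -> set T) : (forall s, measurable (Q s)) ->
  measurable [set w | Q (obs_index K (Y w)) w].
Proof.
move=> mQ; pose idx (b : {ffun 'I_n -> bool} * {ffun 'I_n * 'I_n -> bool}) :=
  sort (fun i j => b.2 (i, j)) [seq i <- enum 'I_n | b.1 i].
rewrite (_ : mkset _ = [set w | exists b, order_data (Y w) = b /\ Q (idx b) w]).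
  apply: measurable_exists => b.
  exact: measurableI (mdata b) (mQ _).
apply/seteqP; split => w /=; rewrite obs_index_data.
  by move=> ?; exists (order_data (Y w)).
by move=> [b [->]].
Qed.

Lemma measurable_fun_obs_index d' (T' : measurableType d') (G : seq 'I_n -> T -> T') :
  (forall s, measurable_fun [set: T] (G s)) ->
  measurable_fun [set: T] (fun w => G (obs_index K (Y w)) w).
Proof.
move=> mG _ B mB; rewrite setTI.
apply: (measurable_obs_index (Q := fun s => G s @^-1` B)) => s.
by rewrite -[X in measurable X]setTI; exact: mG.
Qed.

Lemma measurable_obs_count (Q : pred nat) : measurable [set w | Q (obs_count K (Y w))].
Proof.
under eq_set do rewrite obs_countE.
by apply: (measurable_obs_index (Q := fun s => [set _ | Q (size s)])) => s; exact: measurable_Prop.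
Qed.

Let proj_at (s : seq 'I_n) j w :=
  wproj K (nth (wvertex K) (wvertex K :: [seq Y w i | i <- s]) j).

Let measurable_proj_at s j : measurable_fun [set: T] (proj_at s j).
Proof.
rewrite /proj_at; case: j => [|j] /=; first exact: measurable_cst.
elim: s j => [|i s IHs] [|j] //=; exact: measurable_cst.
Qed.

Lemma measurable_proj_stat j : measurable_fun [set: T] (fun w => proj_stat K (Y w) j).
Proof.
rewrite (_ : (fun w => _) = (fun w => proj_at (obs_index K (Y w)) j w)).
  by apply: (measurable_fun_obs_index (G := fun s => proj_at s j)) => s.
by apply/funext => w; rewrite /proj_stat /order_stat observationsE.
Qed.

Lemma measurable_proj_stat_count :
  measurable_fun [set: T] (fun w => proj_stat K (Y w) (obs_count K (Y w))).
Proof.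
rewrite (_ : (fun w => _) =
  (fun w => proj_at (obs_index K (Y w)) (size (obs_index K (Y w))) w)).
  by apply: (measurable_fun_obs_index (G := fun s => proj_at s (size s))) => s.
by apply/funext => w; rewrite /proj_stat /order_stat observationsE obs_countE.
Qed.

Lemma measurable_admissible j k : measurable [set w | admissible K (Y w) j k].
Proof. exact: (measurable_obs_count (fun N => (j < k <= N)%N && (1 < k - j)%N)). Qed.

Lemma measurable_T_stat j k : measurable_fun [set: T] (fun w => T_stat K (Y w) j k).
Proof.
apply: measurable_sum => l; apply: measurable_beta_ratio; apply: measurable_funB;
  exact/measurable_funX/measurable_proj_stat.
Qed.

Section with_density.
Context (nu : probability 'rV[R]_d R) (f : 'rV[R]_d -> R) (nuf : density nu f).
Hypothesis K0 : wdir K != 0.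

(** Admissibility is part of the event because it makes the ranks at most N; there [TU_stat] agrees
    with [TU], an expression in [wmass] that is measurable everywhere. *)
Lemma measurable_TU_stat_set j k (B : set R) : measurable B ->
  measurable [set w | admissible K (Y w) j k /\ B (TU_stat f K (Y w) j k)].
Proof.
move=> mB; pose F j w := wmass nu K (proj_stat K (Y w) j) *
  (wmass nu K (proj_stat K (Y w) (obs_count K (Y w))))^-1.
pose TU w := \sum_(j.+1 <= l < k) beta_kernel ((F l w - F j w) / (F k w - F j w)).
have mH := measurable_wmass nuf K0.
have mF i : measurable_fun [set: T] (F i).
  apply: measurable_funM; first exact: measurableT_comp mH (measurable_proj_stat i).
  apply: (measurableT_comp measurable_inv).
  exact: measurableT_comp mH measurable_proj_stat_count.
have mTU : measurable_fun [set: T] TU.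
  by apply: measurable_sum => l; apply: measurable_beta_ratio; exact: measurable_funB.
rewrite (_ : mkset _ = [set w | admissible K (Y w) j k] `&` TU @^-1` B).
  apply: measurableI; first exact: measurable_admissible.
  by rewrite -[X in measurable X]setTI; exact: mTU.
have TUE w : admissible K (Y w) j k -> TU_stat f K (Y w) j k = TU w.
  by move=> /andP[/andP[_ kN] _]; rewrite (TU_statE nuf).
by apply/seteqP; split => w /= [adm]; rewrite TUE.
Qed.

End with_density.

End measurable_order_statistics.

(** * Measurability of the random monotonicity hypotheses *)

Section measurable_monotonicity.
Context {R : realType} {d : nat} {disp : measure_display} {T : measurableType disp}.
Implicit Types (K : wedge_shape R d) (g : 'rV[R]_d -> R) (v : 'rV[R]_d).

Lemma increasing_on_sub g v (A B : set 'rV[R]_d) :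
  A `<=` B -> increasing_on g v B -> increasing_on g v A.
Proof. by move=> AB incB e0 t1 t2 ? ? ? /AB ? /AB ?; exact: incB. Qed.

Lemma shell_subset K a a' b b' : a <= a' -> b' <= b -> shell K a' b' `<=` shell K a b.
Proof.
move=> aa' b'b x [Kx /andP[ax xb]]; split => //.
by rewrite (le_lt_trans aa' ax) (le_trans xb b'b).
Qed.

(* The failure of monotonicity on [shell K a b] is witnessed by two points strictly
   above [a], so the set of such pairs [(a, b)] is a countable union of rectangles. *)
Lemma measurable_increasing K g v (a b : T -> R) :
  measurable_fun [set: T] a -> measurable_fun [set: T] b ->
  measurable [set w | increasing_on g v (shell K (a w) (b w))].
Proof.
move=> ma mb; pose U (q : rat) := [set z | ~ increasing_on g v (shell K (ratr q) z)].
have mU q : measurable (U q).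
  (* Shells grow with their upper end, so a failure of monotonicity persists: [U q] is upward
     closed, hence an interval. *)
  apply: is_interval_measurable => x z Ux _ t /andP[xt _] inct.
  by apply: Ux; apply: increasing_on_sub inct; exact: shell_subset.
rewrite (_ : mkset _ = ~` [set w | exists q : rat, a w < ratr q /\ U q (b w)]).
  apply: measurableC; apply: measurable_exists => q; apply: measurableI.
    by apply: measurable_set_bool; exact: measurable_fun_ltr.
  by rewrite -[X in measurable X]setTI; exact: mb.
apply/seteqP; split => w /=.
  move=> incw [q [aq]]; apply; apply: increasing_on_sub incw.
  exact: shell_subset (ltW aq) _.
move=> /forallNP noq e0 t1 t2 u0 t10 t12 A1 A2.
set x1 := v + t1 *: e0 in A1 *; set x2 := v + t2 *: e0 in A2 *.
(* Both witnesses project strictly above [a w], which leaves room for a rational lower end. The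
   upper end may be attained, so it stays [b w]. *)
have : a w < Num.min (wproj K x1) (wproj K x2).
  by rewrite lt_min; case: A1 => _ /andP[-> _]; case: A2 => _ /andP[-> _].
move=> /rat_in_itvoo[q]; rewrite in_itv/= lt_min => /andP[aq /andP[q1 q2]].
have := noq q; rewrite /U/= => /not_andP[//|/contrapT inc].
apply: inc => //.
- by case: A1 => K1 /andP[_ x1b]; split => //; rewrite q1.
- by case: A2 => K2 /andP[_ x2b]; split => //; rewrite q2.
Qed.

Lemma decreasing_onE g v (A : set 'rV[R]_d) :
  decreasing_on g v A = increasing_on (fun x => - g x) v A.
Proof.
apply/propext; split; first exact: decreasing_onN.
by move=> inc e0 t1 t2 ? ? ? ? ?; rewrite -lerN2; exact: inc.
Qed.

End measurable_monotonicity.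

Section max_statistic.
Context {R : realType} {d n : nat} {I : finType}.
Context (f : 'rV[R]_d -> R) (Ks : I -> wedge_shape R d) (y : 'I_n -> 'rV[R]_d).

Definition scaled_stat i j k : R :=
  Num.sqrt (3 / (k - j - 1)%:R) * `|TU_stat f (Ks i) y j k| - penalty (n := n) j k.

Lemma max_stat_leP (t : \bar R) : reflect
  (forall i j k, admissible (Ks i) y j k -> ((scaled_stat i j k)%:E <= t)%E)
  (max_stat f Ks y <= t)%E.
Proof.
apply: (iffP idP) => [+ i j k adm|h].
  move=> /bigmax_leP[_ /(_ i isT)].
  have /andP[/andP[jk kN] _] := adm.
  have jN : (j < (obs_count (Ks i) y).+1)%N by rewrite ltnS (leq_trans (ltnW jk)).
  move=> /bigmax_leP[_ /(_ (Ordinal jN) isT)].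
  have kN' : (k < (obs_count (Ks i) y).+1)%N by rewrite ltnS.
  by move=> /bigmax_leP[_ /(_ (Ordinal kN') adm)].
apply/bigmax_leP; split => [|i _]; first exact: leNye.
apply/bigmax_leP; split => [|j _]; first exact: leNye.
apply/bigmax_leP; split => [|k adm]; first exact: leNye.
exact: h.
Qed.

End max_statistic.

(** * Conditional quantiles and false rejections *)

Section quantile.
Context {R : realType} {disp : measure_display} {T : measurableType disp}.

(** In a chain every finite union is contained in one of its members, whatever the order of the
    indices; continuity from below does the rest. *)
Lemma measure_bigcup_chain_le (mu : {measure set T -> \bar R}) (E : nat -> set T) (c : \bar R) :
  (forall i, measurable (E i)) -> (forall i j, E i `<=` E j \/ E j `<=` E i) ->
  (forall i, (mu (E i) <= c)%E) -> (mu (\bigcup_i E i) <= c)%E.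
Proof.
move=> mE chain Ec; pose F n := \bigcup_(i < n.+1) E i.
have mF n : measurable (F n) by apply: bigcup_measurable => i _.
have FE n : exists i, F n `<=` E i.
  elim: n => [|n [i FE]]; first by exists 0%N => x [j /=]; rewrite ltnS leqn0 => /eqP ->.
  have FS : F n.+1 `<=` F n `|` E n.+1.
    move=> x [j /=]; rewrite ltnS leq_eqVlt => /predU1P[->|jn] Ejx; first by right.
    by left; exists j.
  have [iS|Si] := chain i n.+1; [exists n.+1|exists i] => x /FS[/FE|] //; auto.
have -> : \bigcup_i E i = \bigcup_n F n.
  apply/seteqP; split => x [i _]; first by move=> Ex; exists i => //; exists i => /=.
  by move=> [j _ Ex]; exists j.
have cF : mu \o F @ \oo --> mu (\bigcup_n F n).
  apply: nondecreasing_cvg_mu => //; first exact: bigcupT_measurable.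
  move=> m n mn; apply/subsetPset => x [i /= im Ex]; exists i => //=.
  exact: leq_trans im _.
apply: cvge_le cF; apply: nearW => n /=; have [i Fi] := FE n.
by apply: le_trans (Ec i); apply: le_measure; rewrite ?inE.
Qed.

Context (P : probability T R) (A : set T) (M : T -> \bar R).
Hypothesis mA : measurable A.
Hypothesis mM : forall t : R, measurable [set w | A w /\ (M w <= t%:E)%E].

Let gtE (t : R) : [set w | A w /\ (t%:E < M w)%E] = A `\` [set w | A w /\ (M w <= t%:E)%E].
Proof.
apply/seteqP; split => w /= [Aw]; first by rewrite ltNge => /negP Mt; split => // -[].
by move=> /not_andP[//|/negP]; rewrite -ltNge.
Qed.

Lemma measurable_lt_ereal (k : \bar R) : measurable [set w | A w /\ (k < M w)%E].
Proof.
have mr (t : R) : measurable [set w | A w /\ (t%:E < M w)%E].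
  by rewrite gtE; exact: measurableD.
case: k => [r||]; first exact: mr.
  by rewrite (_ : mkset _ = set0)//; apply/seteqP; split => w //= -[_]; rewrite ltNge leey.
rewrite (_ : mkset _ = [set w | exists n : nat, A w /\ ((- n%:R)%:E < M w)%E]).
  by apply: measurable_exists => n; exact: mr.
apply/seteqP; split => w /=; last first.
  by move=> [n [Aw nM]]; split => //; apply: lt_trans nM; rewrite ltNyr.
move=> [Aw]; case: (M w) => [r||] // _; last by exists 0%N; rewrite ltry.
exists (Num.truncn `|r|).+1; split => //; rewrite lte_fin.
have := truncnS_gt `|r|; have := ler_norm (- r); rewrite normrN; lra.
Qed.

(** A threshold t in [S] satisfies P(A, t < M) <= alpha P(A) by taking complements. As the infimum k
    may lie outside [S], {k < M} is written as the union of the nested events {u n < M} for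
    thresholds u n converging to k. *)
Lemma quantile_bound (alpha : R) : 0 <= alpha ->
  (P [set w | A w /\ (ereal_inf [set t%:E | t in [set t : R | (1 - alpha <=
      fine (P [set w | A w /\ (M w <= t%:E)%E]) / fine (P A))%R]] < M w)%E] <=
   alpha%:E * P A)%E.
Proof.
move=> alpha0; set S := [set t : R | _]; set k := ereal_inf _.
(* Without any threshold the infimum is +oo and nothing exceeds it. *)
have [S0|/set0P S0] := eqVneq S set0.
  rewrite (_ : mkset _ = set0) ?measure0 ?mule_ge0//.
  by apply/seteqP; split => w //= -[_]; rewrite /k S0 image_set0 ereal_inf0 ltNge leey.
have St t : S t -> (P [set w | A w /\ (t%:E < M w)%E] <= alpha%:E * P A)%E.
  move=> /= Sat; have finA : P A \is a fin_num by exact: fin_num_measure.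
  have finB : P [set w | A w /\ (M w <= t%:E)%E] \is a fin_num by exact: fin_num_measure.
  have BA : [set w | A w /\ (M w <= t%:E)%E] `<=` A by move=> w [].
  (* The conditional quotient says nothing when P A = 0, but then both sides are 0. *)
  have [PA0|PA0] := eqVneq (P A) 0%E.
    rewrite PA0 mule0 -PA0; apply: le_measure; rewrite ?inE//; last by move=> w [].
    exact: measurable_lt_ereal.
  rewrite gtE measureD//; last by rewrite ltey_eq finA.
  rewrite (setIidr BA).
  move: Sat; rewrite /S/= ler_pdivlMr; last first.
    by rewrite fine_gt0// lt0e PA0 measure_ge0 /= ltey_eq finA.
  rewrite -(fineK finA) -(fineK finB) -EFinB -EFinM lee_fin/=; lra.
have [u uS ucvg] : {u : (\bar R)^nat | forall i, [set t%:E | t in S] (u i) &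
    u @ \oo --> ereal_inf [set t%:E | t in S]}.
  by apply: ereal_inf_seq; apply/set0P; case: S0 => t St'; exists t%:E, t.
have -> : [set w | A w /\ (k < M w)%E] = \bigcup_n [set w | A w /\ (u n < M w)%E].
  apply/seteqP; split => w /=.
    move=> [Aw kM]; apply: contrapT => nu.
    have : (M w <= k)%E.
      apply: cvge_ge ucvg; apply: nearW => n; rewrite leNgt; apply/negP => uM.
      by apply: nu; exists n.
    by rewrite leNgt kM.
  move=> [n _ [Aw uM]]; split => //; apply: le_lt_trans uM; exact: ereal_inf_lbound.
apply: measure_bigcup_chain_le.
- by move=> n; exact: measurable_lt_ereal.
- move=> i j; have [uij|uji] := leP (u i) (u j); [right|left] => w [Aw uM]; split => //.
    exact: le_lt_trans uM.
  exact: le_lt_trans (ltW uji) uM.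
- by move=> n; have [t Stt <-] := uS n; exact: St.
Qed.

End quantile.

Lemma measure_le_of_fibers {R : realType} {disp : measure_display} {T : measurableType disp}
    (P : probability T R) (F : finType) (g : T -> F) (E : set T) (c : \bar R) :
  (0 <= c)%E -> (forall m, measurable [set w | g w = m]) -> measurable E ->
  (forall m, P (E `&` [set w | g w = m]) <= c * P [set w | g w = m])%E ->
  (P E <= c)%E.
Proof.
move=> c0 mg mE Ec.
have cover (B : set T) : B = \bigcup_(m in [set: F]) (B `&` [set w | g w = m]).
  apply/seteqP; split => w; first by move=> Bw; exists (g w).
  by move=> [m _ []].
have finF : finite_set [set: F] by exact: finite_finset.
have triv (B : set T) : trivIset [set: F] (fun m => B `&` [set w | g w = m]).
  by move=> m m' _ _ [w [[_ <-] [_ <-]]].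
rewrite (cover E) measure_fin_bigcup//; last by move=> m _; exact: measurableI.
apply: (@le_trans _ _ (\sum_(m \in [set: F]) c * P (setT `&` [set w | g w = m]))%E).
  by apply: lee_fsum => // m _; rewrite setTI; exact: Ec.
rewrite -ge0_mule_fsumr// -measure_fin_bigcup//; last by move=> m _; exact: measurableI.
by rewrite -cover [X in (c * X)%E]probability_setT mule1.
Qed.

(** The scale in the critical value is the inverse of the one in the maximum statistic, so division
    isolates the quantile. For [kap] = +oo the premise is false, for -oo the conclusion is
    immediate. *)
Lemma ereal_lt_rejection {R : realType} (j k : nat) (kap : \bar R) (pen t u : R) :
  (1 < k - j)%N -> t <= u ->
  ((Num.sqrt ((k - j - 1)%:R / 3))%:E * (kap + pen%:E) < t%:E)%E ->
  (kap < (Num.sqrt (3 / (k - j - 1)%:R) * u - pen)%:E)%E.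
Proof.
move=> jk tu; have m0 : 0 < (k - j - 1)%:R :> R by rewrite ltr0n subn_gt0.
have s0 : 0 < Num.sqrt ((k - j - 1)%:R / 3) :> R by rewrite sqrtr_gt0 divr_gt0.
have -> : Num.sqrt (3 / (k - j - 1)%:R) = (Num.sqrt ((k - j - 1)%:R / 3))^-1 :> R.
  by rewrite -sqrtrV ?divr_ge0// ?invf_div// ltW.
case: kap => [r||] /=; last by rewrite ltNyr.
  rewrite -EFinD -EFinM !lte_fin => rt.
  rewrite ltrBrDr mulrC ltr_pdivlMr// mulrC; exact: lt_le_trans tu.
by rewrite addye// gt0_muley ?lte_fin// ltNge leey.
Qed.

(** * The false rejection event and its probability *)

Section false_rejections.
Context {R : realType} {d n : nat} {I : finType}.
Context {disp : measure_display} {T : measurableType disp} {P : probability T R}.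
Context (f : 'rV[R]_d -> R) (Ks : I -> wedge_shape R d) (X : 'I_n -> {RV P >-> 'rV[R]_d}).
Hypotheses (Xf : forall i, has_density (X i) f) (indX : mutually_independent X).
Hypotheses (d0 : (0 < d)%N) (K0 : forall i, wdir (Ks i) != 0).
Context (i0 : 'I_n) (alpha : R).
Hypothesis alpha0 : 0 <= alpha.
Local Notation y := (sample X).
Local Notation H i := (wmass (distribution P (X i0)) (Ks i)).

Let mX i : measurable_fun [set: T] (fun w => y w i).
Proof. exact: measurable_funPT. Qed.

Let A m := [set w | obs_counts Ks (y w) = m].

Let mA m : measurable (A m).
Proof.
rewrite (_ : A m = [set w | forall i, obs_count (Ks i) (y w) == m i]).
  apply: measurable_forall => i.
  exact: (measurable_obs_count _ mX (fun N => N == m i)).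
apply/seteqP; split => w /=; first by move=> <- i; rewrite ffunE.
by move=> h; apply/ffunP => i; rewrite ffunE; exact/eqP.
Qed.

Let mmax m (t : R) : measurable [set w | A m w /\ (max_stat f Ks (y w) <= t%:E)%E].
Proof.
apply: measurableI => //.
rewrite [X in measurable X](_ : _ = [set w | forall ijk : I * nat * nat,
  ~ (admissible (Ks ijk.1.1) (y w) ijk.1.2 ijk.2 /\
     [set x | t < Num.sqrt (3 / (ijk.2 - ijk.1.2 - 1)%:R) * `|x| -
        penalty (n := n) ijk.1.2 ijk.2] (TU_stat f (Ks ijk.1.1) (y w) ijk.1.2 ijk.2))]).
  apply: measurable_forall => -[[i j] k] /=; apply: measurableC.
  have mB : measurable [set x : R |
      t < Num.sqrt (3 / (k - j - 1)%:R) * `|x| - penalty (n := n) j k].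
    apply: measurable_set_bool; apply: measurable_fun_ltr => //.
    by apply: measurable_funB => //; exact: measurable_funM.
  exact: (measurable_TU_stat_set mX (distribution_density Xf i0) (K0 i) _ _ mB).
apply/seteqP; split => w /=.
  move=> /max_stat_leP h [[i j] k] /= [/h]; rewrite lee_fin => le_t.
  by rewrite ltNge le_t.
move=> h; apply/max_stat_leP => i j k adm; rewrite lee_fin leNgt; apply/negP => gt_t.
exact: (h (i, j, k)).
Qed.

Let kap := kappa f Ks X alpha.

Let exceed := [set w | (kap (obs_counts Ks (y w)) < max_stat f Ks (y w))%E].

Let exceedE m : exceed `&` A m = [set w | A m w /\ (kap m < max_stat f Ks (y w))%E].
Proof. by apply/seteqP; split => w; rewrite /exceed /A/= => -[+ Am]; rewrite ?Am => ->. Qed.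

Let fiber (m : {ffun I -> 'I_n.+1}) : {ffun I -> nat} := [ffun i => m i : nat].

(** [obs_counts] lives in an infinite type. No count exceeds [n], so [inord] loses nothing and
    [measure_le_of_fibers], which sums over a finite type, becomes applicable. *)
Let counts w : {ffun I -> 'I_n.+1} := [ffun i => inord (obs_count (Ks i) (y w))].

Let obs_count_le i w : (obs_count (Ks i) (y w) <= n)%N.
Proof.
rewrite obs_countE size_sort size_filter (leq_trans (count_size _ _))//.
by rewrite size_enum_ord.
Qed.

Let countsE m : [set w | counts w = m] = A (fiber m).
Proof.
apply/seteqP; split => w; rewrite /A/=.
  by move=> <-; apply/ffunP => i; rewrite !ffunE inordK// ltnS.
move=> /ffunP Am; apply/ffunP => i; have := Am i; rewrite !ffunE => ->.
by rewrite inord_val.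
Qed.

Let measurable_exceed : measurable exceed.
Proof.
rewrite (_ : exceed = [set w | exists m, (exceed `&` A m) w]).
  apply: measurable_exists => m; rewrite exceedE.
  by apply: measurable_lt_ereal => // t; exact: mmax.
apply/seteqP; split => w; first by move=> ?; exists (obs_counts Ks (y w)).
by move=> [m []].
Qed.

Let exceed_le : (P exceed <= alpha%:E)%E.
Proof.
apply: (@measure_le_of_fibers _ _ _ _ _ counts) => //.
- by move=> m; rewrite countsE.
- move=> m; rewrite countsE exceedE.
  by apply: quantile_bound => // t; exact: mmax.
Qed.

(** The first alternative, mass zero, is a tie with X_(0), the vertex. *)
Let tie := [set w | exists i,
  (exists a, wset (Ks i) (y w a) /\ H i (wproj (Ks i) (y w a)) = 0) \/
  (exists ab : 'I_n * 'I_n, ab.1 != ab.2 /\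
    [/\ wset (Ks i) (y w ab.1), wset (Ks i) (y w ab.2) &
        H i (wproj (Ks i) (y w ab.1)) = H i (wproj (Ks i) (y w ab.2))])].

Let tie_null : P.-negligible tie.
Proof.
apply: negligible_exists => i.
have mH a : measurable_fun [set: T] (fun w => H i (wproj (Ks i) (y w a))).
  exact: measurableT_comp (measurable_wmass_wproj (distribution_density Xf i0) (K0 i)) (mX a).
have mK a : measurable [set w | wset (Ks i) (y w a)].
  rewrite -[X in measurable X]setTI.
  exact: mX measurableT _ (measurable_wset (Ks i)).
apply: negligibleU; apply: negligible_exists.
  move=> a; apply/negligibleP; last exact: (no_zero Xf i0 (K0 i) a).
  apply: measurableI; first exact: mK.
  rewrite -[X in measurable X]setTI.
  exact: (mH a measurableT _ (measurable_set1 0)).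
move=> [a b] /=; have [ab|ab] := eqVneq a b.
  by exists set0; split => // w [].
apply: negligibleS (_ : P.-negligible [set w | [/\ wset (Ks i) (y w a), wset (Ks i) (y w b) &
        H i (wproj (Ks i) (y w a)) = H i (wproj (Ks i) (y w b))]]); first by move=> w [].
apply/negligibleP; last exact: (no_tie Xf indX i0 (K0 i) ab).
rewrite (_ : mkset _ = [set w | wset (Ks i) (y w a)] `&` [set w | wset (Ks i) (y w b)] `&`
  [set w | H i (wproj (Ks i) (y w a)) == H i (wproj (Ks i) (y w b))]).
  apply: measurableI; first exact: measurableI.
  by apply: measurable_set_bool; exact: measurable_fun_eqr.
apply/seteqP; split => w /=; last by move=> [[? ?] /eqP ?].
by move=> [? ? /eqP ?].
Qed.

Let c := critical_value f Ks X alpha.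

Definition rejection_event := [set w : T | exists i j k,
  admissible (Ks i) (y w) j k /\
  let A := subsection (Ks i) (y w) j k in
  let t := (T_stat (Ks i) (y w) j k)%:E in
  (increasing_on f (wvertex (Ks i)) A /\ (t < - c w j k)%E) \/
  (decreasing_on f (wvertex (Ks i)) A /\ (c w j k < t)%E)].

Let crit m j k : \bar R :=
  ((Num.sqrt ((k - j - 1)%:R / 3))%:E * (kap m + (penalty (n := n) j k)%:E))%E.

Lemma measurable_false_rejection : measurable rejection_event.
Proof.
(* Once the counts [m] are fixed, the random critical value is the constant [crit m j k]; the union
   over [m] is countable. *)
rewrite (_ : rejection_event = [set w | exists i j k m, A m w /\
    (admissible (Ks i) (y w) j k /\
    ((increasing_on f (wvertex (Ks i)) (subsection (Ks i) (y w) j k) /\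
        ((T_stat (Ks i) (y w) j k)%:E < - crit m j k)%E) \/
     (decreasing_on f (wvertex (Ks i)) (subsection (Ks i) (y w) j k) /\
        (crit m j k < (T_stat (Ks i) (y w) j k)%:E)%E)))]).
  apply: measurable_exists => i; apply: measurable_exists => j.
  apply: measurable_exists => k; apply: measurable_exists => m.
  apply: measurableI => //.
  apply: measurableI; first exact: measurable_admissible.
  have mT := measurable_T_stat (Ks i) mX j k.
  have mp l := measurable_proj_stat (Ks i) mX l.
  apply: measurableU; apply: measurableI.
  - exact: measurable_increasing.
  - rewrite -[X in measurable X]setTI.
    apply: (mT measurableT [set t | (t%:E < - crit m j k)%E]).
    apply: is_interval_measurable => a b /= _ bc t /andP[_ tb].
    by apply: le_lt_trans bc; rewrite lee_fin.
  - rewrite [X in measurable X](_ : _ = [set w | increasing_on (fun x => - f x)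
      (wvertex (Ks i)) (subsection (Ks i) (y w) j k)]).
      exact: measurable_increasing.
    by apply/funext => w; rewrite decreasing_onE.
  - rewrite -[X in measurable X]setTI.
    apply: (mT measurableT [set t | (crit m j k < t%:E)%E]).
    apply: is_interval_measurable => a b /= ca _ t /andP[at' _].
    by apply: lt_le_trans ca _; rewrite lee_fin.
apply/seteqP; split => w /=.
  by move=> [i [j [k rej]]]; exists i, j, k, (obs_counts Ks (y w)).
by move=> [i [j [k [m [<- rej]]]]]; exists i, j, k.
Qed.

Lemma false_rejection_exceed : rejection_event `<=` tie `|` exceed.
Proof.
move=> w [i [j [k [adm rej]]]]; have [|ntie] := pselect (tie w); [by left|right].
have Hn0 a : wset (Ks i) (y w a) -> H i (wproj (Ks i) (y w a)) <> 0.
  by move=> Ka Ha; apply: ntie; exists i; left; exists a.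
have Hn a b : a != b -> wset (Ks i) (y w a) -> wset (Ks i) (y w b) ->
    H i (wproj (Ks i) (y w a)) <> H i (wproj (Ks i) (y w b)).
  by move=> ab Ka Kb Hab; apply: ntie; exists i; right; exists (a, b).
have /andP[jkN jk1] := adm; rewrite /exceed/= ltNge; apply/negP => /max_stat_leP.
move=> /(_ i j k adm); rewrite leNgt => /negP; apply.
(* A false rejection of increase gives c < - T <= - T^U <= |T^U|; one of decrease gives c < T <= T^U
   <= |T^U|. *)
case: rej => -[mono]; rewrite /= /c /critical_value -/kap.
  rewrite lteNr -EFinN => /ereal_lt_rejection; apply => //.
  have := T_stat_increasing (distribution_density Xf i0) d0 (K0 i) Hn0 Hn jkN mono.
  by move=> TUT; rewrite -normrN (le_trans _ (ler_norm _))// lerN2.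
move=> /ereal_lt_rejection; apply => //.
apply: (le_trans _ (ler_norm _)).
exact: (T_stat_decreasing (distribution_density Xf i0) d0 (K0 i) Hn0 Hn jkN mono).
Qed.

Lemma false_rejection_le : (P rejection_event <= alpha%:E)%E.
Proof.
have [N [mN N0 tieN]] := tie_null.
apply: le_trans exceed_le; apply: (@le_trans _ _ (P (N `|` exceed))).
  apply: le_measure; rewrite ?inE.
  - exact: measurable_false_rejection.
  - exact: measurableU.
  - by move=> w /false_rejection_exceed[/tieN|]; [left|right].
apply: le_trans (measureU2 _ mN measurable_exceed) _.
by rewrite [X in (X + _)%E]N0 add0e.
Qed.

End false_rejections.

Theorem theorem3p2 (R : realType) (d n : nat)
    (disp : measure_display) (T : measurableType disp) (P : probability T R)
    (f : 'rV[R]_d -> R) (X : 'I_n -> {RV P >-> 'rV[R]_d})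
    (alpha C1 C2 eps : R) (M : nat) (e : 'I_M -> 'rV[R]_d)
    (B : 'rV[R]_d -> 'rV[R]_d -> 'M[R]_(d.-1, d)) :
  (0 < d)%N -> (1 < n)%N ->
  (forall i, has_density (X i) f) -> mutually_independent X ->
  0 < alpha < 1 ->
  0 < C1 -> 0 < C2 -> 0 < eps -> family_angle n C2 < pi / 2 ->
  greedy_directions (separation d n C2 eps) e ->
  (forall x0 e0, unit_vector e0 -> orthonormal_basis_perp e0 (B x0 e0)) ->
  let K := wedge_family d n C1 C2 eps e B in
  let c := critical_value f K X alpha in
  let false_rejection := [set w : T | exists i j k,
    admissible (K i) (sample X w) j k /\
    let A := subsection (K i) (sample X w) j k in
    let t := (T_stat (K i) (sample X w) j k)%:E in
    (increasing_on f (wvertex (K i)) A /\ (t < - c w j k)%E) \/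
    (decreasing_on f (wvertex (K i)) A /\ (c w j k < t)%E)] in
  measurable false_rejection /\ (P false_rejection <= alpha%:E)%E.
Proof.
move=> d0 n1 Xf indX /andP[/ltW alpha0 _] _ _ _ _ [_ unit_e _ _] _ K c.
have K0 i : wdir (K i) != 0 by exact: unit_vector_neq0 (unit_e i.2).
(* The common law is read off from the first observation, which exists since n > 1. *)
pose i0 : 'I_n := Ordinal (ltnW n1).
split; first exact: measurable_false_rejection.
exact: (false_rejection_le Xf indX d0 K0 i0 alpha0).
Qed.
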